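(* Let $p\ge 1$ be an integer, let $\alpha_1,\alpha_2,\alpha_3\in\mathbb{C}$ satisfy $\Re(\alpha_j)>p-1$ for $j=1,2,3$, and let $A>O$ be a constant $p\times p$ Hermitian positive definite matrix. Let $E[\cdot]$ denote the average over the $p\times p$ complex matrix-variate type-2 Dirichlet measure in two matrices $(\tilde X_1,\tilde X_2)$ with parameters $(\alpha_1,\alpha_2;\alpha_3)$, and let $$\phi_6(\tilde X_1,\tilde X_2)=e^{-\mathrm{tr}(A\tilde X_1)}\,|\det(I+\tilde X_1)|^{\alpha_1+\alpha_3}.$$ Then $$E[\phi_6]=\frac{\tilde\Gamma_p(\alpha_1+\alpha_3)}{\tilde\Gamma_p(\alpha_3)}\,|\det(A)|^{-\alpha_1}.$$
   Context: For Hermitian matrices, $A>O$ means $A$ is positive definite; $I$ is the $p\times p$ identity. For a $p\times p$ Hermitian matrix variable $\tilde X=(x_{ij}+\mathrm{i}\,y_{ij})$, $d\tilde X=\prod_{i\le j}dx_{ij}\prod_{i<j}dy_{ij}$ (Lebesgue measure in the independent real coordinates). $|\det(\cdot)|$ is the absolute value of the determinant. The complex matrix-variate gamma function is $\tilde\Gamma_p(\alpha)=\pi^{p(p-1)/2}\,\Gamma(\alpha)\Gamma(\alpha-1)\cdots\Gamma(\alpha-(p-1))$ for $\Re(\alpha)>p-1$. The type-2 Dirichlet measure in two matrices with parameters $(\alpha_1,\alpha_2;\alpha_3)$ has density $$f_2(\tilde X_1,\tilde X_2)=\frac{\tilde\Gamma_p(\alpha_1+\alpha_2+\alpha_3)}{\tilde\Gamma_p(\alpha_1)\tilde\Gamma_p(\alpha_2)\tilde\Gamma_p(\alpha_3)}|\det(\tilde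 X_1)|^{\alpha_1-p}|\det(\tilde X_2)|^{\alpha_2-p}|\det(I+\tilde X_1+\tilde X_2)|^{-(\alpha_1+\alpha_2+\alpha_3)}$$ on the set of pairs of $p\times p$ Hermitian positive definite matrices. The Dirichlet average of $\phi$ is $E[\phi]=\int\phi\,f_2\,d\tilde X_1\,d\tilde X_2$. *)

(* Defs.v *)
From HB Require Import structures.
From mathcomp Require Import all_boot all_order all_algebra.
From mathcomp Require Import sesquilinear spectral.
From mathcomp Require Import all_classical all_reals all_analysis.
From mathcomp Require Import complex.

Set Implicit Arguments.
Unset Strict Implicit.
Unset Printing Implicit Defensive.

Import Order.TTheory GRing.Theory Num.Theory.
Import numFieldNormedType.Exports.
Local Open Scope classical_set_scope.
Local Open Scope ring_scope.
Local Open Scope complex_scope.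
Local Open Scope sesquilinear_scope.

(** Lebesgue measure on [R^n], on the product sigma-algebra of [n.-tuple R]:
    the n-fold product of [lebesgue_measure], transported along
    [(x, t) |-> x :: t]. *)
Section lebesgue_tuple.
Variable R : realType.
Local Notation Rn n := (n.-tuple (measurableTypeR R)).

Definition cons_pair n (z : (measurableTypeR R * Rn n)%type) : Rn n.+1 :=
  [tuple of z.1 :: z.2].

Lemma measurable_cons_pair n : measurable_fun setT (@cons_pair n).
Proof. exact: measurable_cons. Qed.

Section cons_measure.
Variable n : nat.
Variable m : {sigma_finite_measure set (Rn n) -> \bar R}.

Definition cons_measure : set (Rn n.+1) -> \bar R :=
  pushforward (lebesgue_measure \x m)%E (@cons_pair n).

Let cons_measure0 : cons_measure set0 = 0%E.
Proof. by rewrite /cons_measure /pushforward preimage_set0 measure0. Qed.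

Let cons_measure_ge0 A : (0 <= cons_measure A)%E.
Proof. by rewrite /cons_measure /pushforward measure_ge0. Qed.

Let cons_measure_sigma_additive : semi_sigma_additive cons_measure.
Proof.
have mcons (A : set (Rn n.+1)) :
    measurable A -> measurable (@cons_pair n @^-1` A).
  by move=> mA; rewrite -[X in measurable X]setTI; exact: measurable_cons_pair.
move=> F mF tF mUF; rewrite /cons_measure /pushforward preimage_bigcup.
apply: measure_semi_sigma_additive.
- by move=> k; exact: mcons.
- apply/trivIsetP => /= i j _ _ ij; rewrite -preimage_setI.
  by move/trivIsetP : tF => /(_ _ _ _ _ ij) ->//; rewrite preimage_set0.
- by rewrite -preimage_bigcup; exact: mcons.
Qed.

HB.instance Definition _ := isMeasure.Build _ _ _ cons_measure
  cons_measure0 cons_measure_ge0 cons_measure_sigma_additive.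

Let cons_measure_sigma_finite : sigma_finite setT cons_measure.
Proof.
have /sigma_finiteP[F [TF ndF Foo]] :=
  sigma_finiteT (@lebesgue_measure R : {sigma_finite_measure set _ -> \bar R}).
have /sigma_finiteP[G [TG ndG Goo]] := sigma_finiteT m.
pose g (t : Rn n.+1) : (measurableTypeR R * Rn n)%type :=
  (tnth t ord0, [tuple of behead t]).
have mg : measurable_fun setT g.
  by apply/measurable_fun_pairP; split;
    [exact: measurable_tnth|exact: measurable_behead].
have gK z : g (cons_pair z) = z.
  by case: z => x t; congr pair; apply/val_inj.
exists (fun k => g @^-1` (F k `*` G k)).
  apply/seteqP; split => // t _.
  have [i _ Fi] : (\bigcup_i F i) (g t).1 by rewrite -TF.
  have [j _ Gj] : (\bigcup_i G i) (g t).2 by rewrite -TG.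
  exists (maxn i j) => //; split.
  - by move: Fi; exact/subsetPset/ndF/leq_maxl.
  - by move: Gj; exact/subsetPset/ndG/leq_maxr.
move=> k; have [mF Fk] := Foo k; have [mG Gk] := Goo k; split.
  by rewrite -[X in measurable X]setTI; apply: mg => //; exact: measurableX.
rewrite /cons_measure /pushforward (_ : _ @^-1` _ = F k `*` G k); last first.
  by apply/funext => z; rewrite /preimage /mkset gK.
by rewrite product_measure1E// lte_mul_pinfty// ge0_fin_numE.
Qed.

HB.instance Definition _ := Measure_isSigmaFinite.Build _ _ _ cons_measure
  cons_measure_sigma_finite.

End cons_measure.

Fixpoint lebesgue_tuple n : {sigma_finite_measure set (Rn n) -> \bar R} :=
  match n with
  | 0 => dirac [tuple]
  | n'.+1 => cons_measure (lebesgue_tuple n')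
  end.

Lemma lebesgue_tuple_box n (A : 'I_n -> set (measurableTypeR R)) :
  (forall i, measurable (A i)) ->
  lebesgue_tuple n [set t | forall i, A i (tnth t i)] =
  (\prod_(i < n) lebesgue_measure (A i))%E.
Proof.
elim: n A => [|n IHn] A mA.
  by rewrite big_ord0 /= diracE mem_set// => -[].
rewrite big_ord_recl /= /cons_measure /pushforward.
rewrite (_ : _ @^-1` _ = A ord0 `*`
    [set t | forall i, A (lift ord0 i) (tnth t i)]); last first.
  apply/seteqP; split => -[x t] /=.
    move=> At; split; first exact: (At ord0).
    by move=> i; have := At (lift ord0 i); rewrite tnthS.
  move=> [Ax At] i; case: (unliftP ord0 i) => [j|] -> //.
  by rewrite tnthS.
rewrite product_measure1E//; first by
  rewrite -(IHn (fun i => A (lift ord0 i))).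
rewrite (_ : [set t | _] = \bigcap_(i in [set: 'I_n])
   ((fun t : Rn n => tnth t i) @^-1` A (lift ord0 i))); last first.
  by apply/seteqP; split => t /= At i; [move=> _|]; exact: At.
apply: fin_bigcap_measurable => [|i _]; first exact: finite_finset.
by rewrite -[X in measurable X]setTI; exact: measurable_tnth.
Qed.

End lebesgue_tuple.

Section complex_functions.
Variable R : realType.

Definition cexp (z : R[i]) : R[i] :=
  (expR (complex.Re z))%:C * (cos (complex.Im z) +i* sin (complex.Im z)).

(** Meaningful for [0 < x] only. *)
Definition cpow (x : R) (z : R[i]) : R[i] := cexp (z * (ln x)%:C).

Section integral.
Context d (T : measurableType d) (mu : {measure set T -> \bar R}).

Definition cintegrable (D : set T) (f : T -> R[i]) : Prop :=
  mu.-integrable D (fun x => (complex.Re (f x))%:E) /\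
  mu.-integrable D (fun x => (complex.Im (f x))%:E).

Definition cintegral (D : set T) (f : T -> R[i]) : R[i] :=
  Rintegral mu D (fun x => complex.Re (f x)) +i*
  Rintegral mu D (fun x => complex.Im (f x)).

End integral.

(** Euler's integral: this is the Gamma function on [0 < Re z], the only
    region where it is used below. *)
Definition cGamma (z : R[i]) : R[i] :=
  cintegral lebesgue_measure `]0, +oo[
    (fun t : R => cpow t (z - 1) * (expR (- t))%:C).

Definition cGamma_mx (p : nat) (a : R[i]) : R[i] :=
  (pi ^+ ((p * p.-1)./2))%:C * \prod_(j < p) cGamma (a - j%:R).

End complex_functions.

Section hermitian_matrices.
Variables (R : realType) (p : nat).

Definition posdefmx (A : 'M[R[i]]_p) : Prop :=
  A \is hermsymmx /\
  forall v : 'cV[R[i]]_p, v != 0 -> 0 < (v ^t* *m A *m v) 0 0.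

Definition absdet (A : 'M[R[i]]_p) : R := Normc.normc (\det A).

(** A Hermitian matrix is given by [p * p] independent real coordinates, laid
    out as a real square matrix [c]: [c i j] is [x_ij] for [i <= j], and
    [c j i] is [y_ij] for [i < j]. *)
Definition herm_mx (t : (p * p).-tuple (measurableTypeR R)) : 'M[R[i]]_p :=
  let c i j : R := tnth t (mxvec_index i j) in
  \matrix_(i, j)
    if (i < j)%N then c i j +i* c j i
    else if (j < i)%N then c j i -i* c i j
    else (c i i)%:C.

Definition herm_measure := @lebesgue_tuple R (p * p).

Definition posdef_pairs :
    set ((p * p).-tuple (measurableTypeR R) * (p * p).-tuple (measurableTypeR R)) :=
  [set t | posdefmx (herm_mx t.1) /\ posdefmx (herm_mx t.2)].

Definition dirichlet2_density (a1 a2 a3 : R[i]) (X1 X2 : 'M[R[i]]_p) : R[i] :=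
  cGamma_mx p (a1 + a2 + a3) /
    (cGamma_mx p a1 * cGamma_mx p a2 * cGamma_mx p a3) *
  cpow (absdet X1) (a1 - p%:R) *
  cpow (absdet X2) (a2 - p%:R) *
  cpow (absdet (1%:M + X1 + X2)) (- (a1 + a2 + a3)).

Definition dirichlet2_integrable (a1 a2 a3 : R[i])
    (phi : 'M[R[i]]_p -> 'M[R[i]]_p -> R[i]) : Prop :=
  cintegrable (herm_measure \x herm_measure)%E posdef_pairs
    (fun t => phi (herm_mx t.1) (herm_mx t.2) *
              dirichlet2_density a1 a2 a3 (herm_mx t.1) (herm_mx t.2)).

Definition dirichlet2_average (a1 a2 a3 : R[i])
    (phi : 'M[R[i]]_p -> 'M[R[i]]_p -> R[i]) : R[i] :=
  cintegral (herm_measure \x herm_measure)%E posdef_pairs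
    (fun t => phi (herm_mx t.1) (herm_mx t.2) *
              dirichlet2_density a1 a2 a3 (herm_mx t.1) (herm_mx t.2)).

Definition phi6 (A : 'M[R[i]]_p) (a1 a3 : R[i]) (X1 X2 : 'M[R[i]]_p) : R[i] :=
  cexp (- \tr (A *m X1)) * cpow (absdet (1%:M + X1)) (a1 + a3).

End hermitian_matrices.

(* Main.v *)
(** The matrix gamma integral of [exp (- tr (A X)) |X|^(a - p)] over the positive
    definite [X] is computed by induction on [p]: the coordinates
    [X = [[x, v^*], [v, Y + v v^* / x]]] preserve Lebesgue measure (for fixed
    [x, v] they are a translation) and factor the integral into a scalar Gamma
    integral in [x], a Gaussian integral in [v] and a matrix gamma integral in [Y].
    Writing [Gamma_p(s) |B + Y|^-s] as such an integral and exchanging the order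
    of integration gives the type-2 beta integral. With [B = I + X_1] it evaluates
    the inner [X_2]-integral of the average: the power of [|I + X_1|] it leaves
    cancels the one in [phi_6], and what remains in [X_1] is again a matrix gamma
    integral. Since the density divides by gamma values at complex parameters,
    [Gamma z <> 0] is needed: by the functional equation a zero at [z] gives
    zeros at all [z + n], which is excluded for large real part. *)
Require Import Defs.
From HB Require Import structures.
From mathcomp Require Import all_boot all_order all_algebra.
From mathcomp Require Import sesquilinear spectral.
From mathcomp Require Import all_classical all_reals all_analysis.
From mathcomp Require Import measurable_realfun complex ring lra.
Import Order.TTheory GRing.Theory Num.Theory.
Import numFieldNormedType.Exports.
Set Implicit Arguments.
Unset Strict Implicit.
Unset Printing Implicit Defensive.
Local Open Scope classical_set_scope.
Local Open Scope ring_scope.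
Local Open Scope complex_scope.
Local Open Scope sesquilinear_scope.

(** Every exchange of integrals has to be justified at complex parameters. The modulus of a matrix
    gamma integrand is the same integrand with its parameter replaced by the real part, because the
    trace of a product of two Hermitian matrices is real. In the type-2 beta integral and in the
    average each inner integral is therefore evaluated twice by one formula: at the given parameters
    for the value, at their real parts for Tonelli's criterion. Sets of integration are carried as
    indicator factors, so that inner integrals exist, possibly as zero, at every point.

    The induction on [p] uses two opposite Schur decompositions: the constant matrix is split at its
    lower right block [B], the variable [X] at its upper left entry [x]. Then [tr (A X)] is a term
    in [x], a term in [Y] and a completed square in [v] with matrix [B / x], and the Gaussian
    integral supplies exactly the power of [x] that turns the exponent [a - p] into [a - 1].

    Coordinates only move by permutations, translations and scalings of a line, so no Jacobian
    determinant of a matrix map has to be computed. *)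

Section complex_basics.
Variable R : realType.
Implicit Types (x y r : R) (z w : R[i]).

Lemma ReD z w : complex.Re (z + w) = complex.Re z + complex.Re w.
Proof. by case: z w => [a b] [c d]. Qed.
Lemma ImD z w : complex.Im (z + w) = complex.Im z + complex.Im w.
Proof. by case: z w => [a b] [c d]. Qed.
Lemma ReN z : complex.Re (- z) = - complex.Re z.
Proof. by case: z. Qed.
Lemma ImN z : complex.Im (- z) = - complex.Im z.
Proof. by case: z. Qed.
Lemma ReM z w : complex.Re (z * w) =
  complex.Re z * complex.Re w - complex.Im z * complex.Im w.
Proof. by case: z w => [a b] [c d]. Qed.
Lemma ImM z w : complex.Im (z * w) =
  complex.Re z * complex.Im w + complex.Im z * complex.Re w.
Proof. by case: z w => [a b] [c d]. Qed.

Lemma natC (n : nat) : n%:R = (n%:R : R)%:C.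
Proof. by rewrite rmorph_nat. Qed.

Lemma Re_nat (n : nat) : complex.Re (n%:R : R[i]) = n%:R.
Proof. by rewrite natC. Qed.

Lemma conjCE z : Num.conj z = conjc z.
Proof. by []. Qed.

Lemma cexpD z w : cexp (z + w) = cexp z * cexp w.
Proof.
rewrite /cexp ReD ImD expRD cosD sinD.
by apply/eqP; rewrite eq_complex; apply/andP; split; apply/eqP;
  rewrite !(ReM, ImM) /=; ring.
Qed.

Lemma cexp0 : cexp (0 : R[i]) = 1.
Proof. by rewrite /cexp /= expR0 cos0 sin0 mul1r. Qed.

Lemma cexpR x : cexp x%:C = (expR x)%:C.
Proof. by rewrite /cexp /= cos0 sin0 mulr1. Qed.

Lemma normc_real x : Normc.normc (x%:C : R[i]) = `|x|.
Proof. by rewrite /= expr0n addr0 sqrtr_sqr. Qed.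

Lemma normc_cexp z : Normc.normc (cexp z) = expR (complex.Re z).
Proof.
rewrite /cexp Normc.normcM normc_real ger0_norm ?expR_ge0//=.
by rewrite cos2Dsin2 sqrtr1 mulr1.
Qed.

Lemma cexp_neq0 z : cexp z != 0.
Proof.
apply/negP => /eqP h; have := normc_cexp z; rewrite h Normc.normc0 => /esym/eqP.
by rewrite expR_eq0.
Qed.

Lemma cpowD x z w : cpow x (z + w) = cpow x z * cpow x w.
Proof. by rewrite /cpow mulrDl cexpD. Qed.

Lemma cpowMl x y z : 0 < x -> 0 < y -> cpow (x * y) z = cpow x z * cpow y z.
Proof. by move=> x0 y0; rewrite /cpow lnM ?posrE// rmorphD/= mulrDr cexpD. Qed.

Lemma cpow0 x : cpow x 0 = 1.
Proof. by rewrite /cpow mul0r cexp0. Qed.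

Lemma cpow1l z : cpow 1 z = 1.
Proof. by rewrite /cpow ln1 mulr0 cexp0. Qed.

Lemma cpow_neq0 x z : cpow x z != 0.
Proof. exact: cexp_neq0. Qed.

Lemma cpowN x z : cpow x (- z) = (cpow x z)^-1.
Proof.
apply: (mulIf (cpow_neq0 x z)).
by rewrite -cpowD addNr cpow0 mulVf// cpow_neq0.
Qed.

Lemma cpowE x z : cpow x z = (expR (complex.Re z * ln x))%:C *
  (cos (complex.Im z * ln x) +i* sin (complex.Im z * ln x)).
Proof. by rewrite /cpow /cexp ReM ImM /= !mulr0 subr0 add0r. Qed.

Lemma cpow_real x y : 0 < x -> cpow x y%:C = (x `^ y)%:C.
Proof. by move=> x0; rewrite /cpow -rmorphM cexpR /powR gt_eqF. Qed.

Lemma cpow_nat x (n : nat) : 0 < x -> cpow x n%:R = (x ^+ n)%:C.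
Proof. by move=> x0; rewrite natC cpow_real// powR_mulrn// ltW. Qed.

Lemma normc_cpow x z : Normc.normc (cpow x z) = expR (complex.Re z * ln x).
Proof. by rewrite /cpow normc_cexp ReM /= mulr0 subr0. Qed.

Lemma normc_cpowE x z :
  (Normc.normc (cpow x z))%:C = cpow x (complex.Re z)%:C.
Proof. by rewrite normc_cpow /cpow -rmorphM cexpR. Qed.

Lemma normc_ge0 z : 0 <= Normc.normc z.
Proof. by case: z => a b; exact: sqrtr_ge0. Qed.

Lemma Re_le_normc z : `|complex.Re z| <= Normc.normc z.
Proof.
case: z => a b /=; rewrite -sqrtr_sqr ler_sqrt ?lerDl ?sqr_ge0//.
by rewrite addr_ge0// sqr_ge0.
Qed.

Lemma Im_le_normc z : `|complex.Im z| <= Normc.normc z.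
Proof.
case: z => a b /=; rewrite -sqrtr_sqr ler_sqrt ?lerDr ?sqr_ge0//.
by rewrite addr_ge0// sqr_ge0.
Qed.

Lemma normc_le_ReIm z :
  Normc.normc z <= `|complex.Re z| + `|complex.Im z|.
Proof.
case: z => a b /=; rewrite -[leRHS]ger0_norm ?addr_ge0// -sqrtr_sqr.
rewrite ler_sqrt ?sqr_ge0// sqrrD !real_normK ?num_real// lerD2r lerDl.
by rewrite mulrn_wge0// mulr_ge0.
Qed.

End complex_basics.

(** * Integrals of complex-valued functions *)

Section cmeasurable.
Context d (T : measurableType d) (R : realType).
Implicit Types (f g : T -> R[i]) (h : T -> R).

Definition cmeasurable f :=
  measurable_fun setT (fun x => complex.Re (f x)) /\
  measurable_fun setT (fun x => complex.Im (f x)).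

Lemma cmeasurable_cst (c : R[i]) : cmeasurable (fun=> c).
Proof. by split; exact: measurable_cst. Qed.

Lemma cmeasurable_real h : measurable_fun setT h ->
  cmeasurable (fun x => (h x)%:C).
Proof. by move=> mh; split => //=; exact: measurable_cst. Qed.

Lemma cmeasurable_Complex (h1 h2 : T -> R) : measurable_fun setT h1 ->
  measurable_fun setT h2 -> cmeasurable (fun x => h1 x +i* h2 x).
Proof. by []. Qed.

Lemma cmeasurableD f g : cmeasurable f -> cmeasurable g ->
  cmeasurable (fun x => f x + g x).
Proof.
move=> [f1 f2] [g1 g2]; split.
- under eq_fun do rewrite ReD; exact: measurable_funD.
- under eq_fun do rewrite ImD; exact: measurable_funD.
Qed.

Lemma cmeasurableN f : cmeasurable f -> cmeasurable (fun x => - f x).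
Proof.
move=> [f1 f2]; split.
- under eq_fun do rewrite ReN; exact: measurableT_comp.
- under eq_fun do rewrite ImN; exact: measurableT_comp.
Qed.

Lemma cmeasurableM f g : cmeasurable f -> cmeasurable g ->
  cmeasurable (fun x => f x * g x).
Proof.
move=> [f1 f2] [g1 g2]; split.
- under eq_fun do rewrite ReM.
  by apply: measurable_funB; exact: measurable_funM.
- under eq_fun do rewrite ImM.
  by apply: measurable_funD; exact: measurable_funM.
Qed.

Lemma cmeasurable_conj f : cmeasurable f -> cmeasurable (fun x => Num.conj (f x)).
Proof.
move=> [f1 f2]; split.
- by rewrite (_ : (fun _ => _) = fun x => complex.Re (f x))//; apply/funext => x;
    rewrite conjCE; case: (f x).
- rewrite (_ : (fun _ => _) = fun x => - complex.Im (f x)).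
    exact: measurableT_comp.
  by apply/funext => x; rewrite conjCE; case: (f x).
Qed.

Lemma cmeasurable_sum (I : Type) (s : seq I) (P : pred I) (F : I -> T -> R[i]) :
  (forall i, cmeasurable (F i)) ->
  cmeasurable (fun x => \sum_(i <- s | P i) F i x).
Proof.
move=> mF; elim: s => [|i s IHs].
  by under eq_fun do rewrite big_nil; exact: cmeasurable_cst.
under eq_fun do rewrite big_cons.
by case: (P i) => //; exact: cmeasurableD.
Qed.

Lemma cmeasurable_prod (I : Type) (s : seq I) (P : pred I) (F : I -> T -> R[i]) :
  (forall i, cmeasurable (F i)) ->
  cmeasurable (fun x => \prod_(i <- s | P i) F i x).
Proof.
move=> mF; elim: s => [|i s IHs].
  by under eq_fun do rewrite big_nil; exact: cmeasurable_cst.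
under eq_fun do rewrite big_cons.
by case: (P i) => //; exact: cmeasurableM.
Qed.

Lemma measurable_normc f : cmeasurable f ->
  measurable_fun setT (fun x => Normc.normc (f x)).
Proof.
move=> [f1 f2].
rewrite (_ : (fun _ => _) = fun x =>
  Num.sqrt (complex.Re (f x) ^+ 2 + complex.Im (f x) ^+ 2)); last first.
  by apply/funext => x; case: (f x).
apply: (measurableT_comp (continuous_measurable_fun (@sqrt_continuous R))).
by apply: measurable_funD; apply: measurable_funX.
Qed.

Lemma cmeasurable_cexp f : cmeasurable f -> cmeasurable (fun x => cexp (f x)).
Proof.
move=> [f1 f2]; apply: cmeasurableM.
  by apply: cmeasurable_real; apply: measurableT_comp f1.
apply: cmeasurable_Complex.
- by apply: measurableT_comp f2; exact: (continuous_measurable_fun (@continuous_cos R)).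
- by apply: measurableT_comp f2; exact: (continuous_measurable_fun (@continuous_sin R)).
Qed.

Lemma cmeasurable_cpow h (z : R[i]) : measurable_fun setT h ->
  cmeasurable (fun x => cpow (h x) z).
Proof.
move=> mh; apply: cmeasurable_cexp; apply: cmeasurableM.
  exact: cmeasurable_cst.
apply: cmeasurable_real.
exact: (measurableT_comp (@measurable_ln R) mh).
Qed.

Lemma cmeasurable_indic (D : set T) : measurable D ->
  cmeasurable (fun x => (\1_D x)%:C).
Proof. by move=> mD; apply: cmeasurable_real; exact: measurable_indic. Qed.

End cmeasurable.

Lemma cmeasurable_comp d1 d2 (T1 : measurableType d1) (T2 : measurableType d2)
    (R : realType) (f : T2 -> R[i]) (g : T1 -> T2) :
  cmeasurable f -> measurable_fun setT g -> cmeasurable (fun x => f (g x)).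
Proof.
by move=> [f1 f2] mg; split; [exact: (measurableT_comp f1 mg)|exact: (measurableT_comp f2 mg)].
Qed.

Section is_cintegral.
Context d (T : measurableType d) (R : realType).
Variable mu : {measure set T -> \bar R}.
Implicit Types (f g : T -> R[i]).

(** Integrability travels with the value: [Rintegral] returns a real number even for a
    non-integrable function, so the equation alone could hold by default. The domain is always the
    whole space; restrictions enter as indicator factors. *)
Definition is_cintegral f v := cintegrable mu setT f /\ cintegral mu setT f = v.

Lemma eq_is_cintegral f g u v :
  f =1 g -> u = v -> is_cintegral f u -> is_cintegral g v.
Proof. by move=> /funext -> ->. Qed.

Lemma is_cintegral_measurable f v : is_cintegral f v -> cmeasurable f.
Proof.
move=> [[f1 f2] _]; split; apply/measurable_EFinP;
  by [exact: (measurable_int _ f1)|exact: (measurable_int _ f2)].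
Qed.

Lemma is_cintegral_Re f v : is_cintegral f v ->
  (\int[mu]_x (complex.Re (f x))%:E = (complex.Re v)%:E)%E.
Proof.
move=> [[f1 f2] <-] /=; rewrite /Rintegral fineK//.
exact: (integrable_fin_num measurableT f1).
Qed.

Lemma is_cintegral_Im f v : is_cintegral f v ->
  (\int[mu]_x (complex.Im (f x))%:E = (complex.Im v)%:E)%E.
Proof.
move=> [[f1 f2] <-] /=; rewrite /Rintegral fineK//.
exact: (integrable_fin_num measurableT f2).
Qed.

Lemma is_cintegralP f v : cintegrable mu setT f ->
  (\int[mu]_x (complex.Re (f x))%:E = (complex.Re v)%:E)%E ->
  (\int[mu]_x (complex.Im (f x))%:E = (complex.Im v)%:E)%E ->
  is_cintegral f v.
Proof.
move=> fi h1 h2; split => //; rewrite /cintegral /Rintegral h1 h2.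
by case: v {h1 h2}.
Qed.

Lemma is_cintegral0 : is_cintegral (fun=> 0) 0.
Proof.
by apply: is_cintegralP => /=; rewrite ?integral0//; split => /=; exact: integrable0.
Qed.

Lemma cintegrableZl (c : R[i]) f :
  cintegrable mu setT f -> cintegrable mu setT (fun x => c * f x).
Proof.
move=> [f1 f2]; split.
- under eq_fun do rewrite ReM EFinB !EFinM.
  by apply: integrableB => //; apply: integrableZl.
- under eq_fun do rewrite ImM EFinD !EFinM.
  by apply: integrableD => //; apply: integrableZl.
Qed.

Lemma is_cintegralZl c f v :
  is_cintegral f v -> is_cintegral (fun x => c * f x) (c * v).
Proof.
move=> [fi <-]; split; first exact: cintegrableZl.
move: fi => [f1 f2]; rewrite /cintegral.
under eq_Rintegral do rewrite ReM.
under [X in _ +i* X]eq_Rintegral do rewrite ImM.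
have i1 := fun k => integrableZl measurableT k f1.
have i2 := fun k => integrableZl measurableT k f2.
rewrite RintegralB//; [|exact: i1|exact: i2].
rewrite RintegralD//; [|exact: i2|exact: i1].
by rewrite !RintegralZl//; case: c.
Qed.

Lemma is_cintegralD f g u v : is_cintegral f u -> is_cintegral g v ->
  is_cintegral (fun x => f x + g x) (u + v).
Proof.
move=> fu gv; have [[f1 f2] _] := fu; have [[g1 g2] _] := gv.
apply: is_cintegralP.
- split; [under eq_fun do rewrite ReD EFinD|under eq_fun do rewrite ImD EFinD];
    exact: integrableD.
- under eq_integral do rewrite ReD EFinD.
  by rewrite integralD// (is_cintegral_Re fu) (is_cintegral_Re gv) ReD.
- under eq_integral do rewrite ImD EFinD.
  by rewrite integralD// (is_cintegral_Im fu) (is_cintegral_Im gv) ImD.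
Qed.

Lemma is_cintegralZr c f v :
  is_cintegral f v -> is_cintegral (fun x => f x * c) (v * c).
Proof.
move=> /(is_cintegralZl c); rewrite mulrC.
by under eq_fun do rewrite mulrC.
Qed.

Lemma is_cintegral_real (h : T -> R) (r : R) : measurable_fun setT h ->
  (forall x, 0 <= h x) -> (\int[mu]_x (h x)%:E = r%:E)%E ->
  is_cintegral (fun x => (h x)%:C) r%:C.
Proof.
move=> mh h0 hr; apply: is_cintegralP => //=; last by rewrite integral0.
split => /=; last exact: integrable0.
apply/integrableP; split; first exact/measurable_EFinP.
by under eq_integral do rewrite /= ger0_norm//; rewrite hr ltry.
Qed.

Lemma cintegrable_normc f : cmeasurable f ->
  mu.-integrable setT (fun x => (Normc.normc (f x))%:E) -> cintegrable mu setT f.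
Proof.
move=> [mf1 mf2] nf; split; (apply: le_integrable nf => //;
  [exact/measurable_EFinP|move=> x _ /=]); rewrite lee_fin.
- by rewrite [leRHS]ger0_norm ?normc_ge0// Re_le_normc.
- by rewrite [leRHS]ger0_norm ?normc_ge0// Im_le_normc.
Qed.

Lemma normc_cintegrable f : cmeasurable f -> cintegrable mu setT f ->
  mu.-integrable setT (fun x => (Normc.normc (f x))%:E).
Proof.
move=> mf [f1 f2].
apply: (le_integrable _ _ _ (integrableD _ (integrable_norm f1) (integrable_norm f2))) => //.
  by apply/measurable_EFinP; exact: measurable_normc.
move=> x _ /=; rewrite lee_fin ger0_norm ?normc_ge0//.
by rewrite [leRHS]ger0_norm ?addr_ge0// normc_le_ReIm.
Qed.

Lemma is_cintegral_norm f v : is_cintegral f v ->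
  exists r : R, is_cintegral (fun x => (Normc.normc (f x))%:C) r%:C.
Proof.
move=> fv; have mf := is_cintegral_measurable fv; have [fi _] := fv.
have nf := normc_cintegrable mf fi.
exists (fine (\int[mu]_x (Normc.normc (f x))%:E)).
apply: is_cintegral_real; first exact: measurable_normc.
  by move=> x; exact: normc_ge0.
by rewrite fineK//; exact: (integrable_fin_num measurableT nf).
Qed.

Lemma is_cintegral_normE f (r : R) : is_cintegral (fun x => (Normc.normc (f x))%:C) r%:C ->
  (\int[mu]_x (Normc.normc (f x))%:E = r%:E)%E.
Proof. by move/is_cintegral_Re. Qed.

(** The passage back to integrals over a set, the form used by [cGamma] and [dirichlet2_average]. *)
Lemma is_cintegral_indic (D : set T) f v : measurable D ->
  is_cintegral (fun x => (\1_D x)%:C * f x) v ->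
  cintegrable mu D f /\ cintegral mu D f = v.
Proof.
move=> mD; rewrite /is_cintegral /cintegrable /cintegral.
have hR : (fun x => complex.Re ((\1_D x)%:C * f x)) =
    (fun x => complex.Re (f x)) \_ D.
  apply/funext => x; rewrite ReM/= mul0r subr0 patchE indicE.
  by case: (x \in D); rewrite ?mul1r ?mul0r.
have hI : (fun x => complex.Im ((\1_D x)%:C * f x)) =
    (fun x => complex.Im (f x)) \_ D.
  apply/funext => x; rewrite ImM/= mul0r addr0 patchE indicE.
  by case: (x \in D); rewrite ?mul1r ?mul0r.
rewrite hR hI -!Rintegral_mkcond.
have e (h : T -> R) :
    mu.-integrable setT (fun x => ((h \_ D) x)%:E) -> mu.-integrable D (EFin \o h).
  move=> hi; apply/(integrable_mkcond _ mD).
  apply: eq_integrable hi => // x _.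
  by rewrite !patchE /=; case: ifP.
move=> [[f1 f2] <-]; split; last by [].
split; apply: e.
- by apply: eq_integrable f1 => // x _; rewrite -hR.
- by apply: eq_integrable f2 => // x _; rewrite -hI.
Qed.

End is_cintegral.

(** * Change of variables along measure-preserving maps *)

Section pushforward.
Context d1 d2 (X : measurableType d1) (Y : measurableType d2) (R : realType).
Variables (phi : X -> Y) (mphi : measurable_fun setT phi).
Variables (mu : {measure set X -> \bar R}) (nu : {measure set Y -> \bar R}).
Hypothesis nuE : forall A, measurable A -> nu A = mu (phi @^-1` A).

(** In the applications [nu] is a measure given in advance, hence the comparison [nuE] in place of a
    definition as an image measure. Measurability of [f] is a separate premise because that of the
    composite does not imply it. *)
Lemma is_cintegral_pushforward (f : Y -> R[i]) v : cmeasurable f ->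
  is_cintegral mu (fun x => f (phi x)) v -> is_cintegral nu f v.
Proof.
move=> [mf1 mf2] fv; have [[f1 f2] _] := fv.
have key (g : Y -> R) r : measurable_fun setT g ->
    mu.-integrable setT (fun x => (g (phi x))%:E) ->
    (\int[mu]_x (g (phi x))%:E = r%:E)%E ->
    nu.-integrable setT (EFin \o g) /\ (\int[nu]_x (g x)%:E = r%:E)%E.
  move=> mg gi gr.
  have eqn (h : Y -> \bar R) : (\int[nu]_x h x = \int[pushforward mu phi]_x h x)%E.
    by apply: eq_measure_integral => A mA _; exact: nuE.
  have mE : measurable_fun setT (EFin \o g) by exact/measurable_EFinP.
  have gi' : mu.-integrable (phi @^-1` setT) ((EFin \o g) \o phi) by [].
  split.
    apply/integrableP; split => //; rewrite eqn.
    by have /integrableP[] := integrable_pushforward mphi mE gi' measurableT.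
  by rewrite eqn (integral_pushforward mphi mE gi' measurableT).
have [g1 e1] := key _ _ mf1 f1 (is_cintegral_Re fv).
have [g2 e2] := key _ _ mf2 f2 (is_cintegral_Im fv).
exact: is_cintegralP.
Qed.

End pushforward.

(** * Fubini and Tonelli for complex integrands *)

Section fubini.
Context d1 d2 (T1 : measurableType d1) (T2 : measurableType d2) (R : realType).
Variable m1 : {sigma_finite_measure set T1 -> \bar R}.
Variable m2 : {sigma_finite_measure set T2 -> \bar R}.
Implicit Types F : T1 * T2 -> R[i].

Lemma is_cintegral_fubini1 F (G : T1 -> R[i]) v :
  is_cintegral (m1 \x m2)%E F v ->
  (forall x, is_cintegral m2 (fun y => F (x, y)) (G x)) ->
  is_cintegral m1 G v.
Proof.
move=> Fv FG; have [[F1 F2] _] := Fv.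
have e1 : fubini_F m2 (fun z => (complex.Re (F z))%:E) = fun x => (complex.Re (G x))%:E.
  by apply/funext => x; exact: (is_cintegral_Re (FG x)).
have e2 : fubini_F m2 (fun z => (complex.Im (F z))%:E) = fun x => (complex.Im (G x))%:E.
  by apply/funext => x; exact: (is_cintegral_Im (FG x)).
apply: is_cintegralP.
- split; [have := integrable_fubini_F F1|have := integrable_fubini_F F2];
    by rewrite ?e1 ?e2.
- by rewrite -(is_cintegral_Re Fv) -(integral12_prod_meas1 F1) e1.
- by rewrite -(is_cintegral_Im Fv) -(integral12_prod_meas1 F2) e2.
Qed.

Lemma is_cintegral_fubini2 F (G : T2 -> R[i]) v :
  is_cintegral (m1 \x m2)%E F v ->
  (forall y, is_cintegral m1 (fun x => F (x, y)) (G y)) ->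
  is_cintegral m2 G v.
Proof.
move=> Fv FG; have [[F1 F2] _] := Fv.
have e1 : fubini_G m1 (fun z => (complex.Re (F z))%:E) = fun x => (complex.Re (G x))%:E.
  by apply/funext => x; exact: (is_cintegral_Re (FG x)).
have e2 : fubini_G m1 (fun z => (complex.Im (F z))%:E) = fun x => (complex.Im (G x))%:E.
  by apply/funext => x; exact: (is_cintegral_Im (FG x)).
(* The modulus of the inner integral is at most the inner integral of the modulus, whose outer
   integral is finite by Tonelli. *)
have i1 : m2.-integrable setT (fubini_G m1 (fun z => (complex.Re (F z))%:E)).
  apply/integrableP; split; first exact: (measurable_fubini_G F1).
  have := (integrable21ltyP m1 m2 (measurable_int _ F1)).1 F1; apply: le_lt_trans.
  apply: ge0_le_integral => //=.
  - by apply: measurableT_comp => //; exact: (measurable_fubini_G F1).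
  - apply: (measurable_fun_fubini_tonelli_G (abse \o (fun z => (complex.Re (F z))%:E))) => //=.
    by apply: measurableT_comp => //; exact: (measurable_int _ F1).
  - move=> y _; apply: le_abse_integral => //.
    exact: (measurableT_comp (measurable_int _ F1) (measurable_pair2 y)).
have i2 : m2.-integrable setT (fubini_G m1 (fun z => (complex.Im (F z))%:E)).
  apply/integrableP; split; first exact: (measurable_fubini_G F2).
  have := (integrable21ltyP m1 m2 (measurable_int _ F2)).1 F2; apply: le_lt_trans.
  apply: ge0_le_integral => //=.
  - by apply: measurableT_comp => //; exact: (measurable_fubini_G F2).
  - apply: (measurable_fun_fubini_tonelli_G (abse \o (fun z => (complex.Im (F z))%:E))) => //=.
    by apply: measurableT_comp => //; exact: (measurable_int _ F2).
  - move=> y _; apply: le_abse_integral => //.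
    exact: (measurableT_comp (measurable_int _ F2) (measurable_pair2 y)).
apply: is_cintegralP.
- by split; [move: i1|move: i2]; rewrite ?e1 ?e2.
- by rewrite -(is_cintegral_Re Fv) -(integral21_prod_meas1 F1) e1.
- by rewrite -(is_cintegral_Im Fv) -(integral21_prod_meas1 F2) e2.
Qed.

(** [N] is the inner integral of the modulus, and its integrability, witnessed by [M], is Tonelli's
    criterion for [F]. Once [F] is integrable, Fubini identifies its integral with that of [G]. *)
Lemma is_cintegral_prod12 F (G : T1 -> R[i]) (N : T1 -> R) M v :
  cmeasurable F ->
  (forall x, is_cintegral m2 (fun y => F (x, y)) (G x)) ->
  (forall x, is_cintegral m2 (fun y => (Normc.normc (F (x, y)))%:C) (N x)%:C) ->
  is_cintegral m1 (fun x => (N x)%:C) M ->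
  is_cintegral m1 G v ->
  is_cintegral (m1 \x m2)%E F v.
Proof.
move=> mF FG FN NM Gv.
have N0 x : 0 <= N x.
  rewrite -lee_fin -(is_cintegral_normE (FN x)).
  by apply: integral_ge0 => y _; rewrite lee_fin normc_ge0.
have Fi : cintegrable (m1 \x m2)%E setT F.
  apply: cintegrable_normc => //.
  apply/integrable12ltyP; first by apply/measurable_EFinP; exact: measurable_normc.
  under eq_integral => x _.
    under eq_integral do rewrite gee0_abs ?lee_fin ?normc_ge0//.
    rewrite (is_cintegral_normE (FN x)).
    over.
  by rewrite /= (is_cintegral_Re NM) ltry.
have Fc : is_cintegral (m1 \x m2)%E F (cintegral (m1 \x m2)%E setT F) by [].
have [_ <-] := Gv; have [_ ->] := is_cintegral_fubini1 Fc FG.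
by split.
Qed.

Lemma is_cintegral_prod21 F (G : T2 -> R[i]) (N : T2 -> R) M v :
  cmeasurable F ->
  (forall y, is_cintegral m1 (fun x => F (x, y)) (G y)) ->
  (forall y, is_cintegral m1 (fun x => (Normc.normc (F (x, y)))%:C) (N y)%:C) ->
  is_cintegral m2 (fun y => (N y)%:C) M ->
  is_cintegral m2 G v ->
  is_cintegral (m1 \x m2)%E F v.
Proof.
move=> mF FG FN NM Gv.
have N0 x : 0 <= N x.
  rewrite -lee_fin -(is_cintegral_normE (FN x)).
  by apply: integral_ge0 => y _; rewrite lee_fin normc_ge0.
have Fi : cintegrable (m1 \x m2)%E setT F.
  apply: cintegrable_normc => //.
  apply/integrable21ltyP; first by apply/measurable_EFinP; exact: measurable_normc.
  under eq_integral => x _.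
    under eq_integral do rewrite gee0_abs ?lee_fin ?normc_ge0//.
    rewrite (is_cintegral_normE (FN x)).
    over.
  by rewrite /= (is_cintegral_Re NM) ltry.
have Fc : is_cintegral (m1 \x m2)%E F (cintegral (m1 \x m2)%E setT F) by [].
have [_ <-] := Gv; have [_ ->] := is_cintegral_fubini2 Fc FG.
by split.
Qed.

Lemma is_cintegral_prod12_ge0 (F : T1 * T2 -> R) (G : T1 -> R) r :
  measurable_fun setT F -> (forall z, 0 <= F z) ->
  (forall x, is_cintegral m2 (fun y => (F (x, y))%:C) (G x)%:C) ->
  is_cintegral m1 (fun x => (G x)%:C) r%:C ->
  is_cintegral (m1 \x m2)%E (fun z => (F z)%:C) r%:C.
Proof.
move=> mF F0 FG Gr.
apply: (is_cintegral_prod12 (cmeasurable_real mF) FG _ Gr Gr) => x.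
by under eq_fun do rewrite normc_real ger0_norm//; exact: FG.
Qed.

Lemma is_cintegral_tensor (f : T1 -> R[i]) (g : T2 -> R[i]) u v :
  is_cintegral m1 f u -> is_cintegral m2 g v ->
  is_cintegral (m1 \x m2)%E (fun z => f z.1 * g z.2) (u * v).
Proof.
move=> fu gv; have [V gV] := is_cintegral_norm gv; have [U fU] := is_cintegral_norm fu.
apply: (@is_cintegral_prod12 _ (fun x => f x * v) (fun x => Normc.normc (f x) * V) (U%:C * V%:C)).
- apply: cmeasurableM.
    exact: (cmeasurable_comp (is_cintegral_measurable fu) measurable_fst).
  exact: (cmeasurable_comp (is_cintegral_measurable gv) measurable_snd).
- by move=> x /=; exact: is_cintegralZl.
- move=> x /=; under eq_fun do rewrite Normc.normcM rmorphM.
  by rewrite rmorphM; exact: is_cintegralZl.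
- by under eq_fun do rewrite rmorphM; exact: is_cintegralZr.
- exact: is_cintegralZr.
Qed.

End fubini.

(** * Lebesgue measure on tuples *)

Section mscale.
Context d (T : measurableType d) (R : realType) (k : {nonneg R}).
Variable mu : {measure set T -> \bar R}.

Lemma is_cintegral_mscale (f : T -> R[i]) v :
  is_cintegral mu f v -> is_cintegral (mscale k mu) f ((k%:num)%:C * v).
Proof.
move=> fv; have [[f1 f2] _] := fv.
have key (g : T -> R) (r : R) : mu.-integrable setT (EFin \o g) ->
    (\int[mu]_x (g x)%:E = r%:E)%E ->
    (mscale k mu).-integrable setT (EFin \o g) /\
    (\int[mscale k mu]_x (g x)%:E = (k%:num * r)%:E)%E.
  move=> gi gr; have /integrableP[mg gfin] := gi; split.
    apply/integrableP; split => //.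
    rewrite ge0_integral_mscale//; last exact: measurableT_comp.
    by rewrite lte_mul_pinfty// ge0_fin_numE// integral_ge0.
  rewrite integralE ge0_integral_mscale//; last exact: measurable_funepos.
  rewrite ge0_integral_mscale//; last exact: measurable_funeneg.
  rewrite -muleBr//; first by rewrite -integralE gr.
  by rewrite fin_num_adde_defr// (integrable_pos_fin_num _ gi).
have [g1 e1] := key _ _ f1 (is_cintegral_Re fv).
have [g2 e2] := key _ _ f2 (is_cintegral_Im fv).
apply: is_cintegralP => //.
- by rewrite e1 ReM/= mul0r subr0.
- by rewrite e2 ImM/= mul0r addr0.
Qed.
End mscale.

Section lebesgue_line.
Variable R : realType.
Local Notation mu := (@lebesgue_measure R).
Local Notation L := (measurableTypeR R).

(** Lebesgue measure is recognised by its values on half-open intervals, and the preimage of such an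
    interval is one of the same length. *)
Lemma lebesgue_measure_shift (c : R) (A : set L) : measurable A ->
  mu A = mu ((fun x : L => c + x : L) @^-1` A).
Proof.
have mphi : measurable_fun setT (fun x : L => c + x : L).
  exact: (measurable_funD (measurable_cst _) (@measurable_id _ _ _)).
move=> mA; apply: (@lebesgue_measure_unique R (pushforward mu (fun x : L => c + x : L))) => //.
move=> _ [[a b] _ <-]; rewrite /= /pushforward.
rewrite (_ : _ @^-1` _ = `]a - c, b - c]%classic); last first.
  by apply/seteqP; split => x /=; rewrite !in_itv/= ltrBlDl lerBrDl.
by rewrite /= !lebesgue_measure_itv/= !lte_fin ltrD2r -!EFinB opprB addrA subrK.
Qed.

Lemma lebesgue_measure_scale (s : R) (s0 : 0 < s) (A : set L) : measurable A ->
  mu A = (s%:E * mu ((fun x : L => (s * x)%R : L) @^-1` A))%E.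
Proof.
have mphi : measurable_fun setT (fun x : L => s * x : L).
  exact: (measurable_funM (measurable_cst _) (@measurable_id _ _ _)).
pose m := mscale (NngNum (ltW s0)) (pushforward mu (fun x : L => s * x : L)).
move=> mA; rewrite -[RHS]/(m mphi A); apply: lebesgue_measure_unique => //.
move=> _ [[a b] _ <-]; rewrite -[RHS]/(s%:E * mu ((fun x : L => (s * x)%R : L) @^-1` `]a, b]%classic))%E.
rewrite (_ : _ @^-1` _ = `]a / s, b / s]%classic); last first.
  by apply/seteqP; split => x /=; rewrite !in_itv/= ltr_pdivrMr// ler_pdivlMr// ![x * s]mulrC.
rewrite /= !lebesgue_measure_itv/= !lte_fin ltr_pM2r ?invr_gt0//.
case: ifP => _; last by rewrite mule0.
by rewrite -!EFinB -EFinM mulrBr !(mulrC s) !divfK ?gt_eqF.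
Qed.

Lemma is_cintegral_scale (f : L -> R[i]) v s : 0 < s ->
  is_cintegral mu f v -> is_cintegral mu (fun x : L => f (s * x)) ((s^-1)%:C * v).
Proof.
move=> s0 fv.
have si0 : 0 < s^-1 by rewrite invr_gt0.
pose m := mscale (NngNum (ltW si0)) mu.
have ms (c : R) : measurable_fun setT (fun x : L => c * x : L).
  exact: (measurable_funM (measurable_cst _) (@measurable_id _ _ _)).
(* Lebesgue measure is the image of [s^-1] times itself under multiplication by [s^-1]; composing
   with this map turns [f (s * x)] back into [f]. *)
apply: (@is_cintegral_pushforward _ _ _ _ _ _ (ms s^-1) m mu).
- by move=> A mA; rewrite /m /mscale/=; exact: lebesgue_measure_scale.
- exact: (cmeasurable_comp (is_cintegral_measurable fv) (ms s)).
- rewrite (_ : (fun _ => _) = f); first exact: (is_cintegral_mscale (NngNum (ltW si0)) fv).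
  by apply/funext => x; rewrite mulVKf// gt_eqF.
Qed.

End lebesgue_line.

Section lebesgue_tuple_theory.
Variable R : realType.
Local Notation L := (measurableTypeR R).
Local Notation Rn n := (n.-tuple L).

Definition box n (A : 'I_n -> set L) : set (Rn n) := [set t | forall i, A i (tnth t i)].

Lemma measurable_box n (A : 'I_n -> set L) :
  (forall i, measurable (A i)) -> measurable (box A).
Proof.
move=> mA; rewrite (_ : box A = \bigcap_(i in [set: 'I_n])
   ((fun t : Rn n => tnth t i) @^-1` A i)); last first.
  by apply/seteqP; split => t /= At i; [move=> _|]; exact: At.
apply: fin_bigcap_measurable => [|i _]; first exact: finite_finset.
by rewrite -[X in measurable X]setTI; exact: measurable_tnth.
Qed.

(** Boxes are stable under intersection and generate the product sigma-algebra, and the cubes with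
    sides [[-k, k]] have finite measure and exhaust the space. Comparing measures on tuples thus
    reduces to products of side lengths. *)
Lemma lebesgue_tuple_unique n (m : {measure set (Rn n) -> \bar R}) :
  (forall A : 'I_n -> set L, (forall i, measurable (A i)) ->
    m (box A) = (\prod_(i < n) lebesgue_measure (A i))%E) ->
  forall X, measurable X -> lebesgue_tuple R n X = m X.
Proof.
move=> mE.
pose G := [set B : set (Rn n) | exists2 A : 'I_n -> set L,
  (forall i, measurable (A i)) & B = box A].
pose g (k : nat) : set (Rn n) := box (fun _ : 'I_n => `[- k%:R, k%:R]%classic : set L).
apply: (measure_unique G g).
- apply/seteqP; split; last first.
    by apply: smallest_sub; [exact: sigma_algebra_measurable|move=> _ [A mA ->]; exact: measurable_box].
  rewrite {1}/measurable/= /g_sigma_preimage; apply: smallest_sub => //.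
  rewrite -bigcup_seq; apply: bigcup_sub => i _ _ [B mB <-].
  (* A condition on the coordinate [i] alone is a box whose other sides are the whole line. *)
  apply: sub_sigma_algebra; exists (fun j => if j == i then B else setT).
    by move=> j; case: ifP.
  rewrite setTI; apply/seteqP; split => t /=.
    by move=> Bt j; case: eqP => // ->.
  by move=> /(_ i); rewrite eqxx.
- move=> _ _ [A mA ->] [B mB ->]; exists (fun i => A i `&` B i).
    by move=> i; exact: measurableI.
  apply/seteqP; split => t /=; first by move=> [At Bt] i; split; [exact: At|exact: Bt].
  by move=> h; split => i; case: (h i).
- by move=> k; exists (fun=> `[- k%:R, k%:R]%classic).
- apply/seteqP; split => // t _.
  (* The sum of the absolute values bounds all coordinates at once. *)
  pose M := \sum_(i < n) `|tnth t i|.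
  exists (Num.truncn M).+1 => // i /=; rewrite in_itv/= -ler_norml.
  apply: (@le_trans _ _ M); last exact/ltW/truncnS_gt.
  by rewrite /M (bigD1 i)//= lerDl sumr_ge0.
- by move=> _ [A mA ->]; rewrite mE//; exact: lebesgue_tuple_box.
- move=> k.
  have E := @lebesgue_tuple_box R n (fun=> `[(- k%:R)%R, k%:R%R]%classic)
    (fun=> measurable_itv _).
  suff : (\prod_(i < n) @lebesgue_measure R `[(- k%:R)%R, k%:R%R]%classic < +oo)%E.
    by rewrite -E.
  (* Nonnegativity is carried through the induction, since being below [+oo] is not by itself stable
     under products of extended reals. *)
  apply: (@proj2 (0 <= \prod_(i < n) @lebesgue_measure R `[(- k%:R)%R, k%:R%R]%classic)%E).
  elim/big_ind : _ => [|x y [x0 xy] [y0 yy]|i _].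
  - by split; rewrite ?ltry.
  - by split; rewrite ?mule_ge0// lte_mul_pinfty// ge0_fin_numE.
  - rewrite /= lebesgue_measure_itv/=; case: ifP => _; last by split; rewrite ?ltry.
    rewrite -EFinB ltry; split => //; rewrite lee_fin opprK addr_ge0//; exact: ler0n.
Qed.

Definition tadd n (c t : Rn n) : Rn n := [tuple (tnth c i + tnth t i : L) | i < n].

Lemma measurable_tadd d (T : measurableType d) n (f g : T -> Rn n) :
  measurable_fun setT f -> measurable_fun setT g ->
  measurable_fun setT (fun x => tadd (f x) (g x)).
Proof.
move=> /measurable_fun_tnthP mf /measurable_fun_tnthP mg.
apply/measurable_fun_tnthP => i.
rewrite (_ : _ \o _ = fun x => (tnth (f x) i + tnth (g x) i : L)).
  exact: (measurable_funD (mf i) (mg i)).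
by apply/funext => x /=; rewrite tnth_mktuple.
Qed.

Lemma lebesgue_tuple_shift n (c : Rn n) (A : set (Rn n)) : measurable A ->
  lebesgue_tuple R n A = lebesgue_tuple R n (tadd c @^-1` A).
Proof.
have mc : measurable_fun setT (tadd c).
  by apply: measurable_tadd => //; exact: measurable_cst.
pose m : {measure set (Rn n) -> \bar R} := pushforward (lebesgue_tuple R n) (tadd c).
move=> mA; rewrite -[RHS]/(m mc A).
apply: lebesgue_tuple_unique => // B mB; rewrite /= /pushforward.
rewrite (_ : _ @^-1` _ = box (fun i => (fun x : L => tnth c i + x : L) @^-1` B i)); last first.
  by apply/seteqP; split => t /= h i; have := h i; rewrite tnth_mktuple.
apply: (eq_trans (lebesgue_tuple_box _)) => [i|].
  rewrite -[X in measurable X]setTI.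
  have h : measurable_fun setT (fun x : L => tnth c i + x : L).
    exact: (measurable_funD (measurable_cst _) (@measurable_id _ _ _)).
  exact: h.
by apply: eq_bigr => i _; exact/esym/lebesgue_measure_shift.
Qed.

Section shear.
Context d (T : measurableType d) (nu : {measure set T -> \bar R}).
Variables (n : nat) (c : T -> Rn n) (mc : measurable_fun setT c).

Definition shear (z : T * Rn n) : T * Rn n := (z.1, tadd (c z.1) z.2).

Lemma measurable_shear : measurable_fun setT shear.
Proof.
apply/measurable_fun_pairP; split; first exact: measurable_fst.
by apply: measurable_tadd => //; exact: measurableT_comp.
Qed.

(** The measure of a set is the integral over [x] of the measures of its sections, and [shear]
    translates each section by a vector depending on [x] only. *)
Lemma shear_measure (A : set (T * Rn n)) : measurable A ->
  (nu \x lebesgue_tuple R n)%E A = (nu \x lebesgue_tuple R n)%E (shear @^-1` A).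
Proof.
move=> mA; rewrite /product_measure1/=; apply: eq_integral => x _ /=.
rewrite (lebesgue_tuple_shift (c x)); last exact: measurable_xsection.
by congr (lebesgue_tuple R n _).
Qed.

Lemma is_cintegral_shear (f : T * Rn n -> R[i]) v : cmeasurable f ->
  is_cintegral (nu \x lebesgue_tuple R n)%E (fun z => f (shear z)) v ->
  is_cintegral (nu \x lebesgue_tuple R n)%E f v.
Proof.
exact: (is_cintegral_pushforward measurable_shear shear_measure).
Qed.

End shear.

Lemma is_cintegral_tadd n (c : Rn n) (f : Rn n -> R[i]) v :
  is_cintegral (lebesgue_tuple R n) f v ->
  is_cintegral (lebesgue_tuple R n) (fun t => f (tadd c t)) v.
Proof.
move=> fv; pose c' : Rn n := [tuple (- tnth c i : L) | i < n].
have m' e : measurable_fun setT (@tadd n e).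
  by apply: measurable_tadd => //; exact: measurable_cst.
apply: (is_cintegral_pushforward (m' c') (lebesgue_tuple_shift c')).
  exact: (cmeasurable_comp (is_cintegral_measurable fv) (m' c)).
rewrite (_ : (fun _ => _) = f)//; apply/funext => t; congr f.
by apply: eq_from_tnth => i; rewrite !tnth_mktuple addrA subrr add0r.
Qed.

Lemma is_cintegral_cons n (f : Rn n.+1 -> R[i]) v : cmeasurable f ->
  is_cintegral (lebesgue_measure \x lebesgue_tuple R n)%E
    (fun z : L * Rn n => f (cons_pair z)) v ->
  is_cintegral (lebesgue_tuple R n.+1) f v.
Proof. exact: (is_cintegral_pushforward (@measurable_cons_pair R n)). Qed.

End lebesgue_tuple_theory.

(** * The scalar Gamma function *)

Section half_line_FTC.
Variable R : realType.
Local Notation mu := (@lebesgue_measure R).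
Variables F f : R -> R.
Hypothesis dF : forall t : R, 0 < t -> is_derive t 1 F (f t).
Hypothesis cf : forall t : R, 0 < t -> {for t, continuous f}.

(** Compact intervals inside the open half line, since [F] may be singular at 0. For [n = 0] the
    interval is the single point 1, so the fundamental theorem of calculus on [I n] is stated for
    [0 < n]. *)
Let I (n : nat) : set R := `[n.+1%:R^-1, n.+1%:R]%classic.

Let Ipos n t : I n t -> 0 < t.
Proof. by rewrite /I /= in_itv/= => /andP[h _]; apply: lt_le_trans h; rewrite invr_gt0. Qed.

Let Ind : nondecreasing_seq I.
Proof.
apply/nondecreasing_seqP => n; rewrite subsetEset => t; rewrite /I /= !in_itv/=.
move=> /andP[h1 h2]; apply/andP; split.
  by apply: le_trans h1; rewrite lef_pV2 ?posrE// ler_nat.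
by apply: (le_trans h2); rewrite ler_nat.
Qed.

Let Icup : \bigcup_n I n = `]0, +oo[%classic.
Proof.
apply/seteqP; split => [t [n _ /Ipos]|t]; rewrite /= in_itv/= andbT// => t0.
pose N := maxn (Num.truncn t) (Num.truncn t^-1).
have h1 : t <= N.+1%:R.
  by apply/ltW/(lt_le_trans (truncnS_gt t)); rewrite ler_nat ltnS leq_maxl.
have h2 : t^-1 <= N.+1%:R.
  by apply/ltW/(lt_le_trans (truncnS_gt _)); rewrite ler_nat ltnS leq_maxr.
exists N => //; rewrite /I /= in_itv/= h1 andbT.
by rewrite -(invrK t) lef_pV2 ?posrE ?invr_gt0.
Qed.

Let mf : measurable_fun (`]0, +oo[%classic : set R) f.
Proof.
apply: open_continuous_measurable_fun => // x; rewrite inE/= in_itv/= andbT.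
exact: cf.
Qed.

Let cF t : 0 < t -> {for t, continuous F}.
Proof.
by move=> t0; apply: differentiable_continuous; apply/derivable1_diffP; have [] := dF t0.
Qed.

Let FTC n : (0 < n)%N ->
  (\int[mu]_(t in I n) (f t)%:E = (F n.+1%:R - F n.+1%:R^-1)%:E)%E.
Proof.
move=> n0; rewrite EFinB; apply: continuous_FTC2.
- by apply: (@lt_trans _ _ 1); rewrite ?invf_lt1 ?ltr1n.
- apply: continuous_in_subspaceT => t; rewrite inE => /Ipos; exact: cf.
- split => [t|//|].
  + rewrite in_itv/= => /andP[h _]; have t0 : 0 < t by apply: lt_trans h; rewrite invr_gt0.
    by have [] := dF t0.
  + by apply: cvg_at_right_filter; apply: cF; rewrite invr_gt0.
  + by apply: cvg_at_left_filter; apply: cF.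
- move=> t; rewrite in_itv/= => /andP[h _].
  have t0 : 0 < t by apply: lt_trans h; rewrite invr_gt0.
  by have [_ <-] := dF t0; rewrite derive1E.
Qed.

(** Monotone convergence along [I n]. Bounded increments of the primitive suffice, without limits at
    either end: the lemma serves to prove finiteness. *)
Lemma ge0_half_line_FTC_le M : (forall t, 0 < t -> 0 <= f t) ->
  (forall a b, 0 < a -> a <= b -> F b - F a <= M) ->
  (\int[mu]_(t in `]0%R, +oo[) (f t)%:E <= M%:E)%E.
Proof.
move=> f0 FM.
have cv : (\int[mu]_(x in I i) (EFin \o f) x @[i --> \oo] -->
    \int[mu]_(x in `]0%R, +oo[) (EFin \o f) x)%E.
  rewrite -Icup; apply: ge0_nondecreasing_set_cvg_integral => //.
  - by move=> n; exact: measurable_itv.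
  - move=> n; apply/measurable_EFinP; apply: measurable_funS mf => // t /Ipos.
    by rewrite /= in_itv/= andbT.
  - by move=> n t /Ipos t0; rewrite lee_fin f0.
have <- := cvg_lim _ cv => //.
apply: lime_le; first by apply/cvg_ex; eexists; exact: cv.
near=> n; rewrite /= FTC ?lee_fin; last by near: n; exact: nbhs_infty_gt.
apply: FM; first by rewrite invr_gt0.
by apply: (@le_trans _ _ 1); rewrite ?invf_le1 ?ler1n.
Unshelve. all: by end_near. Qed.

(** Dominated convergence along [I n] with bound [|f|], for integrands of no fixed sign. *)
Lemma half_line_FTC0 : mu.-integrable (`]0, +oo[%classic : set R) (EFin \o f) ->
  F n.+1%:R @[n --> \oo] --> 0 -> F n.+1%:R^-1 @[n --> \oo] --> 0 ->
  (\int[mu]_(t in `]0%R, +oo[) (f t)%:E = 0)%E.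
Proof.
move=> fi Fy F0.
have [] := @dominated_convergence _ (measurableTypeR R) R mu (`]0, +oo[%classic : set R) (measurable_itv _)
  (fun n => (EFin \o f) \_ (I n)) (EFin \o f) (abse \o (EFin \o f)).
- move=> n; apply/measurable_restrict => //; first exact: measurable_itv.
  by apply/measurable_EFinP; apply: measurable_funS mf => // t [].
- exact/measurable_EFinP.
- apply: aeW => t; rewrite /= in_itv/= andbT => t0.
  have : (\bigcup_n I n) t by rewrite Icup /= in_itv/= andbT.
  move=> [N _ INt]; apply: cvg_near_cst; near=> n.
  have Nn : (N <= n)%N by near: n; exact: nbhs_infty_ge.
  by rewrite patchE mem_set//; have /subsetPset := Ind Nn; apply.
- exact: integrable_abse.
- apply: aeW => t n t0; rewrite patchE /=; case: ifP => _ /=; rewrite lee_fin//.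
  by rewrite normr0.
move=> _ _ cv.
have cv0 : (\int[mu]_(x in `]0%R, +oo[) ((EFin \o f) \_ (I n)) x @[n --> \oo] --> 0)%E.
  apply: (@cvg_trans _ ((F n.+1%:R - F n.+1%:R^-1)%:E @[n --> \oo])).
    apply: near_eq_cvg; near=> n.
    rewrite -integral_mkcondr -FTC; last by near: n; exact: nbhs_infty_gt.
    by rewrite setIidr// -Icup; exact: bigcup_sup.
  by apply: cvg_EFin; [exact: nearW|rewrite -[0]subr0; exact: cvgB].
have {}cv0 := cvg_unique _ cv0 cv; rewrite -{}cv0 //.
Unshelve. all: by end_near. Qed.

End half_line_FTC.

#[local] Opaque cexp cpow.

(** * Convergence and scaling of Euler's integral *)

Section gamma_integrable.
Variable R : realType.
Local Notation mu := (@lebesgue_measure R).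
Local Notation L := (measurableTypeR R).
Local Notation pos := (`]0, +oo[%classic : set R).

(** This is [ln (1 + u) <= u] at [t = 2 x (1 + u)]. Exponentiated, it bounds [t^x] by
    [(2 x)^x exp (t / 2)], so that half of the decay of [exp (- t)] remains. *)
Lemma ln_le_linear (x t : R) : 0 < x -> 0 < t ->
  x * ln t <= x * ln (2 * x) + t / 2.
Proof.
move=> x0 t0; have x20 : 0 < 2 * x by rewrite mulr_gt0.
have {1}-> : t = (2 * x) * (1 + (t / (2 * x) - 1)) by field; rewrite gt_eqF.
rewrite lnM ?posrE//; last by rewrite addrC subrK divr_gt0.
rewrite mulrDr lerD2l; apply: (@le_trans _ _ (x * (t / (2 * x) - 1))).
  by rewrite ler_pM2l// le_ln1Dx// ltrBrDl subrr divr_gt0.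
rewrite mulrBr mulr1 (_ : x * (t / (2 * x)) = t / 2); last by field; rewrite gt_eqF.
by rewrite lerBlDr lerDl ltW.
Qed.

(** The integrand is dominated by the derivative of a bounded function, which settles both ends of
    the half line at once. With [p t = t^x] one has [1 + p <= K exp (t / 2)], hence
    [exp (- t) <= K^2 / (1 + p)^2], while [t^(x - 1)] is the derivative of [p] divided by [x]. The
    resulting bound [f] has the primitive [F = - C / (1 + p)] with [C = K^2 / x], whose increments
    are at most [C]. *)
Lemma gamma_fin (x : R) : 0 < x ->
  (\int[mu]_(t in pos) (expR ((x - 1) * ln t) * expR (- t))%:E < +oo)%E.
Proof.
move=> x0.
pose p (t : R) := expR (x * ln t).
have dp (t : R) : 0 < t -> is_derive t 1 p (p t * (x / t)).
  move=> t0; apply: is_derive1_comp; apply: is_derive_eq.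
    exact: (is_deriveZ x (is_derive1_ln t0)).
  by [].
pose K := 1 + expR (x * ln (2 * x)).
have K0 : 0 < K by rewrite addr_gt0// expR_gt0.
have pK (t : R) : 0 < t -> 1 + p t <= K * expR (t / 2).
  move=> t0; rewrite mulrDl mul1r lerD//.
    by rewrite -expR0 ler_expR divr_ge0// ltW.
  by rewrite -expRD ler_expR ln_le_linear.
have p1 t : 0 < 1 + p t by rewrite addr_gt0// expR_gt0.
pose C := K ^+ 2 / x.
have C0 : 0 < C by rewrite divr_gt0// exprn_gt0.
pose F (t : R) := - C * (1 + p t)^-1.
pose f (t : R) := C * (1 + p t) ^- 2 * (p t * (x / t)).
have dF (t : R) : 0 < t -> is_derive t 1 F (f t).
  move=> t0.
  have d1 : is_derive t 1 (fun t => 1 + p t) (p t * (x / t)).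
    rewrite -[p t * _]add0r.
    exact: (is_deriveD (is_derive_cst (1 : R) t 1) (dp _ t0)).
  have h := @is_deriveV _ (fun t => 1 + p t) t _ 1 (lt0r_neq0 (p1 t)) d1.
  rewrite (_ : f t = - C *: (- (1 + p t) ^- 2 *: (p t * (x / t)))); last first.
    by rewrite /f /= scalerA mulrNN.
  exact: (is_deriveZ (- C) h).
have cp (t : R) : 0 < t -> {for t, continuous p}.
  move=> t0; apply: differentiable_continuous; apply/derivable1_diffP.
  by have [] := dp _ t0.
have cf (t : R) : 0 < t -> {for t, continuous f}.
  move=> t0; apply: cvgM; last first.
    apply: cvgM; first exact: cp.
    apply: cvgM; first exact: cvg_cst.
    by apply: cvgV; [rewrite gt_eqF|exact: cvg_id].
  apply: cvgM; first exact: cvg_cst.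
  apply: cvgV; first by rewrite expf_neq0// gt_eqF.
  have h : {for t, continuous (fun u => 1 + p u)}.
    by apply: cvgD; [exact: cvg_cst|exact: cp].
  exact: (cvgM h h).
have f0 (t : R) : 0 < t -> 0 <= f t.
  move=> t0; rewrite /f !mulr_ge0 ?invr_ge0 ?exprn_ge0 ?expR_ge0//; exact: ltW.
have FM (a b : R) : 0 < a -> a <= b -> F b - F a <= C.
  move=> a0 ab; rewrite /F !mulNr opprK addrC -mulrBr -[leRHS]mulr1 ler_pM2l//.
  have h1 : (1 + p a)^-1 <= 1 by rewrite invf_le1// lerDl expR_ge0.
  have h2 : 0 <= (1 + p b)^-1 by rewrite invr_ge0 ltW.
  by lra.
apply: le_lt_trans (le_lt_trans (ge0_half_line_FTC_le dF cf f0 FM) (ltry _)).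
apply: ge0_le_integral => //.
- apply: measurable_funTS; apply/measurable_EFinP; apply: measurable_funM.
    by apply: measurableT_comp => //; apply: measurable_funM.
  by apply: measurableT_comp.
- apply/measurable_EFinP; apply: open_continuous_measurable_fun => // t.
  by rewrite inE/= in_itv/= andbT => /cf.
- move=> t; rewrite /= in_itv/= andbT => t0; rewrite lee_fin /f.
  rewrite (_ : (x - 1) * ln t = x * ln t - ln t); last by ring.
  rewrite expRD expRN lnK ?posrE// -/(p t) /C.
  rewrite (_ : _ * (p t * _) = p t / t * (K ^+ 2 / (1 + p t) ^+ 2)); last first.
    by field; rewrite !gt_eqF.
  rewrite ler_pM2l; last by rewrite divr_gt0// expR_gt0.
  rewrite ler_pdivlMr ?exprn_gt0// expRN mulrC ler_pdivrMr ?expR_gt0//.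
  have -> : expR t = expR (t / 2) ^+ 2.
    by rewrite -expRM_natl; congr expR; field.
  by rewrite -exprMn ler_pXn2r// ?nnegrE ?pK ?(ltW (p1 t))// mulr_ge0 ?expR_ge0 ?(ltW K0).
Qed.

Definition gamma_fun (z : R[i]) (t : L) : R[i] :=
  (\1_pos t)%:C * (cpow t (z - 1) * (expR (- t))%:C).

Lemma cmeasurable_gamma_fun z : cmeasurable (gamma_fun z).
Proof.
apply: cmeasurableM; first by apply: cmeasurable_indic; exact: measurable_itv.
apply: cmeasurableM; first exact: (cmeasurable_cpow _ (@measurable_id _ _ _)).
apply: cmeasurable_real.
exact: (measurableT_comp (@measurable_expR R) (@oppr_measurable R setT)).
Qed.

Lemma is_cintegral_gamma z : 0 < complex.Re z ->
  is_cintegral mu (gamma_fun z) (cGamma z).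
Proof.
move=> z0.
have gi : cintegrable mu setT (gamma_fun z).
  apply: cintegrable_normc; first exact: cmeasurable_gamma_fun.
  apply/integrableP; split.
    by apply/measurable_EFinP; apply: measurable_normc; exact: cmeasurable_gamma_fun.
  apply: le_lt_trans (gamma_fin z0); rewrite [leRHS]integral_mkcond.
  apply: ge0_le_integral => //.
  - apply: measurableT_comp => //.
    by apply/measurable_EFinP; apply: measurable_normc; exact: cmeasurable_gamma_fun.
  - apply/(measurable_restrictT _ _).1; first exact: measurable_itv.
    apply: measurable_funTS; apply/measurable_EFinP; apply: measurable_funM.
      by apply: measurableT_comp => //; apply: measurable_funM.
    by apply: measurableT_comp.
  - move=> t _; rewrite gee0_abs ?lee_fin ?normc_ge0// patchE /gamma_fun indicE.
    case: (t \in _); last by rewrite mul0r Normc.normc0.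
    rewrite mul1r Normc.normcM normc_cpow normc_real lee_fin ger0_norm ?expR_ge0//.
    by rewrite ReD.
have gc : is_cintegral mu (gamma_fun z) (cintegral mu setT (gamma_fun z)) by [].
have mp : measurable (pos : set L) by exact: measurable_itv.
by have [_] := is_cintegral_indic mp gc; rewrite /cGamma => ->.
Qed.

Lemma is_cintegral_gamma_scale z s : 0 < complex.Re z -> 0 < s ->
  is_cintegral mu
    (fun t : L => (\1_pos t)%:C * (cpow t (z - 1) * (expR (- (s * t)))%:C))
    (cGamma z * cpow s (- z)).
Proof.
move=> z0 s0.
(* The substitution leaves [s^(z - 1)] in the integrand and [s^-1] in front; the factor [s^(1 - z)]
   cancels the former. *)
have := is_cintegralZl (cpow s (1 - z)) (is_cintegral_scale s0 (is_cintegral_gamma z0)).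
rewrite (_ : _ * (_ * cGamma z) = cGamma z * cpow s (- z)); last first.
  rewrite cpowD -{1}[1]/(1%:R) cpow_nat// expr1 mulrACA -rmorphM.
  by rewrite mulfV ?gt_eqF// mul1r mulrC.
congr is_cintegral; apply/funext => t; rewrite /gamma_fun !indicE.
have -> : (s * t \in pos) = (t \in pos).
  by apply/idP/idP; rewrite !inE /= !in_itv/= !andbT pmulr_rgt0.
have [|_] := boolP (t \in pos); last by rewrite !mul0r mulr0.
rewrite inE /= in_itv/= andbT => t0; rewrite !mul1r cpowMl// -(mulrA (cpow s _)).
by rewrite [LHS]mulrA -cpowD (_ : 1 - z + (z - 1) = 0) ?cpow0 ?mul1r//; ring.
Qed.

End gamma_integrable.

(** * The functional equation *)

Section gamma_recurrence.
Variable R : realType.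
Local Notation mu := (@lebesgue_measure R).
Local Notation L := (measurableTypeR R).
Local Notation pos := (`]0, +oo[%classic : set R).

Section primitive.
Variables (x y : R) (u du : R -> R).
Hypothesis x0 : 0 < x.
Hypothesis u_derive : forall t : R, is_derive t 1 u (du t).
Hypothesis du_continuous : continuous du.
Hypothesis u_le1 : forall t, `|u t| <= 1.

(* For [u] = [cos] and [u] = [sin], [F t] is the real and the imaginary part of
   [t^z exp (-t)], [z = x + i y]. *)
Let F (t : R) := expR (x * ln t) * u (y * ln t) * expR (- t).
Let f (t : R) := ((x / t - 1) * u (y * ln t) + y / t * du (y * ln t)) *
  (expR (x * ln t) * expR (- t)).

Let lnZ (c t : R) : 0 < t -> is_derive t 1 (fun t => c * ln t) (c / t).
Proof. by move=> t0; exact: (is_deriveZ c (is_derive1_ln t0)). Qed.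

Let dF (t : R) : 0 < t -> is_derive t 1 F (f t).
Proof.
move=> t0.
have d1 := @is_derive1_comp _ expR (fun t => x * ln t) t _ _ (is_derive_expR _) (lnZ x t0).
have d2 := @is_derive1_comp _ u (fun t => y * ln t) t _ _ (u_derive _) (lnZ y t0).
have d3 := @is_derive1_comp _ expR -%R t _ _ (is_derive_expR _) (is_deriveNid t (1 : R)).
apply: is_derive_eq (is_deriveM (is_deriveM d1 d2) d3) _.
rewrite /f /GRing.scale /= mulrfctE /=; field; exact: lt0r_neq0.
Qed.

Let c_lnZ (c t : R) : 0 < t -> {for t, continuous (fun t : R => c * ln t : R)}.
Proof.
move=> t0; apply: differentiable_continuous; apply/derivable1_diffP.
by have [] := lnZ c t0.
Qed.

Let cu : continuous u.
Proof.
move=> t; apply: differentiable_continuous; apply/derivable1_diffP.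
by have [] := u_derive t.
Qed.

Let cf (t : R) : 0 < t -> {for t, continuous f}.
Proof.
move=> t0.
have ci (c : R) : {for t, continuous (fun t : R => c / t : R)}.
  by apply: cvgM; [exact: cvg_cst|apply: cvgV; [rewrite gt_eqF|exact: cvg_id]].
apply: cvgM; last first.
  apply: cvgM.
    by apply: (continuous_comp (c_lnZ t0)); exact: continuous_expR.
  apply: (@continuous_comp _ _ _ -%R expR); last exact: continuous_expR.
  exact: opp_continuous.
apply: cvgD; apply: cvgM.
- by apply: cvgB; [exact: ci|exact: cvg_cst].
- by apply: (continuous_comp (c_lnZ t0)); exact: cu.
- exact: ci.
- by apply: (continuous_comp (c_lnZ t0)); exact: du_continuous.
Qed.

Let F_le (t : R) : `|F t| <= expR (x * ln t) * expR (- t).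
Proof.
rewrite /F !normrM !(ger0_norm (expR_ge0 _)) ler_wpM2r ?expR_ge0//.
by rewrite ler_piMr ?expR_ge0.
Qed.

Let Fy : F n.+1%:R @[n --> \oo] --> 0.
Proof.
(* [t^x exp (- t)] is at most [(2 x)^x exp (- t / 2)], and [exp (t / 2) >= t / 2]; hence the bound
   [K / t], with the factor 2 in [K]. *)
pose K := expR (x * ln (2 * x)) * 2.
apply: norm_cvg0; apply: (@squeeze_cvgr _ _ _ _ (cst 0) (K \*: @harmonic R)).
- apply: nearW => n /=; rewrite normr_ge0/= (le_trans (F_le _))//.
  have t0 : 0 < n.+1%:R :> R by [].
  rewrite /harmonic /=; set t := n.+1%:R in t0 *.
  apply: (@le_trans _ _ (expR (x * ln (2 * x)) * expR (- (t / 2)))).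
    rewrite -!expRD ler_expR; have := ln_le_linear x0 t0; lra.
  rewrite /GRing.scale /= /K -[leRHS]mulrA ler_pM2l ?expR_gt0//.
  rewrite expRN -[2 * _]invrK invfM invrK lef_pV2 ?posrE ?expR_gt0 ?divr_gt0 ?mulr_gt0 ?invr_gt0//.
  rewrite mulrC; apply: le_trans (expR_ge1Dx _); lra.
- exact: cvg_cst.
- by rewrite -(scaler0 _ K); exact: (cvgZl_tmp cvg_harmonic).
Qed.

(** Near 0 the exponential is at most 1, and [t^x] tends to 0 because [0 < x]. *)
Let F0 : F n.+1%:R^-1 @[n --> \oo] --> 0.
Proof.
apply: norm_cvg0; apply: (@squeeze_cvgr _ _ _ _ (cst 0) (fun n => harmonic n `^ x)).
- apply: nearW => n /=; rewrite normr_ge0/= (le_trans (F_le _))//.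
  rewrite /powR /harmonic /= gt_eqF ?invr_gt0// ler_piMr ?expR_ge0//.
- exact: cvg_cst.
- have := powR_cvg0 x0 => /cvg_at_rightP /(_ (@harmonic R)); apply.
  by split; [move=> n; rewrite /harmonic /= invr_gt0|exact: cvg_harmonic].
Qed.

Lemma gamma_primitive_integral0 : mu.-integrable pos (EFin \o f) ->
  (\int[mu]_(t in pos) (f t)%:E = 0)%E.
Proof. by move=> fi; exact: (half_line_FTC0 dF cf fi Fy F0). Qed.

End primitive.

(** Integration by parts in disguise: [z] times the integrand at [z] minus the integrand at [z + 1]
    is [(z / t - 1) t^z exp (- t)], the derivative of [t^z exp (- t)], which tends to 0 at both
    ends. Real and imaginary parts are treated apart, with [cos] and [sin] for [u]. *)
Lemma cGammaS (z : R[i]) : 0 < complex.Re z -> cGamma (z + 1) = z * cGamma z.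
Proof.
move=> z0; have z1 : 0 < complex.Re (z + 1) by rewrite ReD addr_gt0.
pose h t := z * gamma_fun z t + (-1) * gamma_fun (z + 1) t.
have hi : is_cintegral mu h (z * cGamma z + (-1) * cGamma (z + 1)).
  by apply: is_cintegralD; apply: is_cintegralZl; exact: is_cintegral_gamma.
pose x := complex.Re z; pose y := complex.Im z.
have hE (t : R) : 0 < t -> h t =
    ((x / t - 1) +i* (y / t)) * (cos (y * ln t) +i* sin (y * ln t)) *
    (expR (x * ln t) * expR (- t))%:C.
  move=> t0; rewrite /h /gamma_fun indicE mem_set/= ?in_itv/= ?t0// !mul1r.
  rewrite (_ : z + 1 - 1 = z); last by ring.
  rewrite cpowD cpowN (_ : cpow t 1 = t%:C); last by rewrite (cpow_nat 1).
  rewrite cpowE -/x -/y rmorphM /=.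
  have -> : (x / t - 1) +i* (y / t) = z / t%:C - 1.
    rewrite -rmorphV/= ?unitfE ?gt_eqF// /x /y.
    by apply/eqP; rewrite eq_complex ReD ImD ReM ImM ReN ImN /=;
      apply/andP; split; apply/eqP; ring.
  by field; rewrite /= eq_complex/= gt_eqF.
have h0 t : t \notin pos -> h t = 0.
  by move=> /negbTE tp; rewrite /h /gamma_fun !indicE tp !mul0r !mulr0 addr0.
(* [P] stands for the real or the imaginary part; [h] vanishes outside the half line, so its
   integral over the line is one over [pos]. *)
have part (P : R[i] -> R) (g : R -> R) : P 0 = 0 ->
    (forall t : R, 0 < t -> P (h t) = g t) ->
    mu.-integrable setT (fun t => (P (h t))%:E) ->
    mu.-integrable pos (EFin \o g) /\
    (\int[mu]_t (P (h t))%:E = \int[mu]_(t in pos) (g t)%:E)%E.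
  move=> P0 Pg Pi; have mpos : measurable (pos : set L) by exact: measurable_itv.
  split.
    apply: (eq_integrable _ (fun t => (P (h t))%:E)) => //.
      by move=> t; rewrite inE/= in_itv/= andbT => /Pg ->.
    exact: integrableS Pi.
  rewrite [RHS]integral_mkcond; apply: eq_integral => t _; rewrite patchE.
  have [|tp] := boolP (t \in pos); last by rewrite h0 // P0.
  by rewrite inE/= in_itv/= andbT => /Pg ->.
have [[hR hI] _] := hi.
pose w (t : R) : R := expR (x * ln t) * expR (- t).
have Re_h (t : R) : 0 < t -> complex.Re (h t) =
    ((x / t - 1) * cos (y * ln t) + y / t * (- sin (y * ln t))) * w t.
  by move=> t0; rewrite hE// /w ReM ReM /=; ring.
have Im_h (t : R) : 0 < t -> complex.Im (h t) =
    ((x / t - 1) * sin (y * ln t) + y / t * cos (y * ln t)) * w t.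
  by move=> t0; rewrite hE// /w ImM ImM /=; ring.
have [iR eR] := part (@complex.Re R) _ erefl Re_h hR.
have [iI eI] := part (@complex.Im R) _ erefl Im_h hI.
have r0 : complex.Re (z * cGamma z + (-1) * cGamma (z + 1)) = 0.
  apply: EFin_inj; rewrite -(is_cintegral_Re hi) eR.
  apply: (@gamma_primitive_integral0 x y cos (fun t => - sin t)) iR => //.
  - by move=> t; apply: cvgN; exact: continuous_sin.
  - exact: cos_max.
have i0 : complex.Im (z * cGamma z + (-1) * cGamma (z + 1)) = 0.
  apply: EFin_inj; rewrite -(is_cintegral_Im hi) eI.
  apply: (@gamma_primitive_integral0 x y sin cos) iI => //.
  - exact: continuous_cos.
  - exact: sin_max.
have : z * cGamma z + (-1) * cGamma (z + 1) == 0.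
  by rewrite eq_complex r0 i0 !eqxx.
by rewrite mulN1r subr_eq0 => /eqP.
Qed.

End gamma_recurrence.

(** * Non-vanishing of Gamma on the right half plane *)

Section gamma_nonvanishing.
Variable R : realType.
Local Notation mu := (@lebesgue_measure R).
Local Notation L := (measurableTypeR R).
Local Notation pos := (`]0, +oo[%classic : set R).

Lemma gamma_fun_normc (z : R[i]) t :
  (Normc.normc (gamma_fun z t))%:C = gamma_fun (complex.Re z)%:C t.
Proof.
rewrite /gamma_fun Normc.normcM normc_real Normc.normcM normc_real.
rewrite ger0_norm ?ger0_norm ?expR_ge0// !rmorphM/= normc_cpowE ReD ReN.
by rewrite rmorphB.
Qed.

Lemma gamma_funE (x t : R) : 0 < t ->
  gamma_fun x%:C t = (expR ((x - 1) * ln t) * expR (- t))%:C.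
Proof.
move=> t0; rewrite /gamma_fun indicE mem_set/= ?in_itv/= ?t0// mul1r rmorphM/=.
rewrite -[1]/(1%:C) -rmorphB cpowE /= mul0r cos0 sin0.
by rewrite (_ : 1 +i* 0 = 1) ?mulr1.
Qed.

Lemma gamma_fun_out (z : R[i]) t : t <= 0 -> gamma_fun z t = 0.
Proof.
move=> t0; rewrite /gamma_fun indicE memNset ?mul0r//= in_itv/= andbT.
by rewrite ltNge t0.
Qed.

Lemma cGamma_gt0 (x : R) : 0 < x -> exists2 g : R, 0 < g & cGamma x%:C = g%:C.
Proof.
move=> x0; have gi := is_cintegral_gamma (x0 : 0 < complex.Re x%:C).
have hE t : gamma_fun x%:C t = (Normc.normc (gamma_fun x%:C t))%:C.
  by rewrite gamma_fun_normc.
have Im0 : complex.Im (cGamma x%:C) = 0.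
  apply: EFin_inj; rewrite -(is_cintegral_Im gi) integral0_eq// => t _.
  by rewrite hE.
exists (complex.Re (cGamma x%:C)); last first.
  by rewrite [LHS]complexE Im0 mulr0 addr0.
(* On [[1, 2]] one has [0 <= ln t <= ln 2] and [t <= 2], so [m] bounds the integrand from below
   whatever the sign of [x - 1]. *)
pose m := expR (- (`|x - 1| * ln 2)) * expR (- 2).
have m0 : 0 < m by rewrite mulr_gt0 ?expR_gt0.
have mI : measurable (`[1, 2]%classic : set L) by exact: measurable_itv.
rewrite -lte_fin -(is_cintegral_Re gi).
apply: (@lt_le_trans _ _ (\int[mu]_t (m * \1_(`[1, 2]%classic : set R) t)%:E)%E).
  under eq_integral do rewrite EFinM.
  rewrite ge0_integralZl//; last 2 first.
  - by apply/measurable_EFinP; exact: measurable_indic.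
  - by rewrite lee_fin ltW.
  rewrite integral_indic// setIT /= lebesgue_measure_itv/= lte_fin ltr1n.
  rewrite -EFinB -EFinM lte_fin mulr_gt0//; lra.
apply: ge0_le_integral => //.
- by move=> t _; rewrite lee_fin mulr_ge0// ltW.
- by apply/measurable_EFinP; apply: measurable_funM.
- by apply/measurable_EFinP; exact: (cmeasurable_gamma_fun _).1.
move=> t _; rewrite lee_fin hE /=; rewrite indicE.
have [|_] := boolP (t \in _); last by rewrite mulr0 normc_ge0.
rewrite inE/= in_itv/= mulr1 => /andP[t1 t2].
have t0 : 0 < t by lra.
rewrite gamma_funE// normc_real ger0_norm ?mulr_ge0 ?expR_ge0//.
rewrite ler_pM ?expR_ge0 ?ler_expR//; last lra.
have l0 : 0 <= ln t by exact: ln_ge0.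
have l2 : ln t <= ln 2 by rewrite ler_ln ?posrE.
have := ler_norm (- (x - 1)); rewrite normrN => n1.
apply: (@le_trans _ _ (- `|x - 1| * ln t)); last by rewrite ler_wpM2r//; lra.
by rewrite mulNr lerN2 ler_wpM2l.
Qed.

Lemma abs_sin_le (v : R) : `|sin v| <= `|v|.
Proof.
wlog v0 : v / 0 < v.
  move=> h; have [v0|v0|<-] := ltgtP 0 v.
  - exact: h.
  - by rewrite -normrN -sinN -(normrN v); apply: h; rewrite oppr_gt0.
  - by rewrite sin0.
have [] := @MVT R sin cos 0 v v0 (fun x _ => is_derive_sin x).
  by apply: continuous_subspaceT; exact: continuous_sin.
move=> c _; rewrite sin0 !subr0 => ->; rewrite normrM.
by rewrite ler_piMl// cos_max.
Qed.

(** [cos u = 1 - 2 sin^2 (u / 2)], together with [|sin v| <= |v|]. *)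
Lemma cos_ge_quadratic (u : R) : 1 - u ^+ 2 / 2 <= cos u.
Proof.
have -> : u = (u / 2) *+ 2 by rewrite -mulr_natr; field.
set v := u / 2; rewrite cos_mulr2n cos2sin2.
have : sin v ^+ 2 <= v ^+ 2.
  by rewrite -[leLHS]real_normK ?num_real// -[leRHS]real_normK ?num_real// ler_pXn2r// ?nnegrE// abs_sin_le.
have -> : (v *+ 2) ^+ 2 / 2 = 2 * v ^+ 2 by rewrite mulr2n; field.
by rewrite !mulr2n; lra.
Qed.

(** From [1 - s^-1 <= ln s <= s - 1], one square for each sign of [ln s]. The bound is a Laurent
    polynomial that vanishes to second order at [s = 1]: times a Gamma integrand it remains a
    combination of Gamma integrands. *)
Lemma ln_sqr_le (s : R) : 0 < s -> ln s ^+ 2 <= (s - 1) ^+ 2 + (1 - s^-1) ^+ 2.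
Proof.
move=> s0; have si0 : 0 < s^-1 by rewrite invr_gt0.
have h1 : ln s <= s - 1.
  by rewrite -{1}[s](subrK 1) addrC le_ln1Dx//; lra.
have h2 : 1 - s^-1 <= ln s.
  have := @le_ln1Dx _ (s^-1 - 1); rewrite [1 + _]addrC subrK lnV ?posrE//.
  by move=> h; have := h _; lra.
have [l0|l0] := leP 0 (ln s).
  have : ln s ^+ 2 <= (s - 1) ^+ 2 by rewrite ler_pXn2r// ?nnegrE//; lra.
  have := sqr_ge0 (1 - s^-1); lra.
have : (- ln s) ^+ 2 <= (- (1 - s^-1)) ^+ 2 by rewrite ler_pXn2r// ?nnegrE//; lra.
rewrite !sqrrN; have := sqr_ge0 (s - 1); lra.
Qed.

(* After rotation by [x^(-iy)] the real part of the Gamma integrand is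
   [t^(x-1) exp (-t) cos (y ln (t/x))]. It is bounded below with
   [1 - u^2/2 <= cos u] and [ln_sqr_le]; the lower bound is a combination of
   integrands of [cGamma (x + k)], [-2 <= k <= 2], all multiples of [cGamma (x - 2)]. *)
Lemma cGamma_neq0_large (z : R[i]) :
  2 * complex.Im z ^+ 2 + 6 <= complex.Re z -> cGamma z != 0.
Proof.
set x := complex.Re z; set y := complex.Im z => hx.
have y2 := sqr_ge0 y.
have x6 : 6 <= x by lra.
have x0 : 0 < x by lra.
have [g g0 gE] : exists2 g : R, 0 < g & cGamma (x - 2)%:C = g%:C.
  by apply: cGamma_gt0; lra.
have S (a : R) : 0 < a -> cGamma (a + 1)%:C = a%:C * cGamma a%:C.
  by move=> a0; rewrite -cGammaS// rmorphD.
have g1 : cGamma (x - 1)%:C = ((x - 2) * g)%:C.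
  by rewrite (_ : x - 1 = x - 2 + 1) ?S ?gE ?rmorphM//; lra.
have g2 : cGamma x%:C = ((x - 1) * (x - 2) * g)%:C.
  by rewrite -[in LHS](subrK 1 x) S ?g1 -?rmorphM ?mulrA//; lra.
have g3 : cGamma (x + 1)%:C = (x * (x - 1) * (x - 2) * g)%:C.
  by rewrite S// g2 -rmorphM !mulrA.
have g4 : cGamma (x + 2)%:C = ((x + 1) * x * (x - 1) * (x - 2) * g)%:C.
  rewrite (_ : x + 2 = x + 1 + 1); last by ring.
  by rewrite S ?g3 -?rmorphM ?mulrA//; lra.
pose G (a t : R) := gamma_fun a%:C t.
(* The coefficients come from [(s - 1)^2 + (1 - s^-1)^2 = s^2 - 2 s + 2 - 2 s^-1 + s^-2] with
   [s = t / x]; a factor [t^k] moves the parameter from [x] to [x + k]. *)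
pose low t := G x t + (- (y ^+ 2 / 2))%:C * ((x ^- 2)%:C * G (x + 2) t +
  ((- 2 / x)%:C * G (x + 1) t + (2%:C * G x t + ((- 2 * x)%:C * G (x - 1) t +
   (x ^+ 2)%:C * G (x - 2) t)))).
have Gi (a : R) : 0 < a -> is_cintegral mu (G a) (cGamma a%:C).
  by move=> a0; exact: is_cintegral_gamma.
have lowi : is_cintegral mu low (cGamma x%:C + (- (y ^+ 2 / 2))%:C * ((x ^- 2)%:C * cGamma (x + 2)%:C +
  ((- 2 / x)%:C * cGamma (x + 1)%:C + (2%:C * cGamma x%:C + ((- 2 * x)%:C * cGamma (x - 1)%:C +
   (x ^+ 2)%:C * cGamma (x - 2)%:C))))).
  have Gx : is_cintegral mu (G x) _ := Gi _ x0.
  have Z c a : 0 < a -> is_cintegral mu (fun t => c%:C * G a t) (c%:C * cGamma a%:C).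
    by move=> a0; exact: is_cintegralZl (Gi _ a0).
  apply: (is_cintegralD Gx); apply: is_cintegralZl.
  have x1 : 0 < x - 1 by lra.
  have x2 : 0 < x - 2 by lra.
  have x3 : 0 < x + 1 by lra.
  have x4 : 0 < x + 2 by lra.
  exact: (is_cintegralD (Z _ _ x4) (is_cintegralD (Z _ _ x3) (is_cintegralD (Z _ _ x0)
    (is_cintegralD (Z _ _ x1) (Z _ _ x2))))).
have z0 : 0 < complex.Re z by [].
(* A constant factor keeps a zero of Gamma, and this one makes the phase vanish at [t = x], around
   which the integrand concentrates for large [x]. *)
have upi := is_cintegralZl (cpow x (- (y%:C * 'i%C))) (is_cintegral_gamma z0).
have le_int : (\int[mu]_t (complex.Re (low t))%:E <=
    \int[mu]_t (complex.Re (cpow x (- (y%:C * 'i%C)) * gamma_fun z t))%:E)%E.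
  apply: le_integral => //; [exact: lowi.1.1|exact: upi.1.1|move=> t _].
  rewrite lee_fin; have [t0|t0] := leP t 0.
    by rewrite /low /G !gamma_fun_out// !(mulr0, addr0).
  pose w := expR ((x - 1) * ln t) * expR (- t).
  have GE (a k : R) : expR ((a - x) * ln t) = k -> G a t = (k * w)%:C.
    by move=> <-; rewrite /G gamma_funE// /w mulrA -[in RHS]expRD -mulrDl addrA subrK.
  have E1 : expR (1 * ln t) = t by rewrite mul1r lnK.
  have G0 : G x t = (1 * w)%:C by apply: GE; rewrite subrr mul0r expR0.
  have G1 : G (x + 1) t = (t * w)%:C by apply: GE; rewrite addrC addKr.
  have G2 : G (x + 2) t = (t ^+ 2 * w)%:C.
    by apply: GE; rewrite addrC addKr expRM_natl lnK.
  have G3 : G (x - 1) t = (t^-1 * w)%:C.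
    by apply: GE; rewrite addrC addKr mulNr expRN E1.
  have G4 : G (x - 2) t = (t ^- 2 * w)%:C.
    by apply: GE; rewrite addrC addKr mulNr expRN expRM_natl lnK.
  set s := t / x; have s0 : 0 < s by rewrite divr_gt0.
  have -> : complex.Re (low t) =
      w * (1 - y ^+ 2 / 2 * ((s - 1) ^+ 2 + (1 - s^-1) ^+ 2)).
    rewrite /low G0 G1 G2 G3 G4 -!rmorphM -!rmorphD -rmorphM -rmorphD /=.
    by rewrite /s; field; rewrite !gt_eqF.
  have -> : complex.Re (cpow x (- (y%:C * 'i%C)) * gamma_fun z t) =
      w * cos (y * ln s).
    rewrite /gamma_fun indicE mem_set/= ?in_itv/= ?t0// mul1r.
    rewrite !cpowE lnM ?posrE ?invr_gt0// lnV ?posrE// mulrBr cosB.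
    rewrite !ReD !ImD !ReN !ImN !ReM !ImM /= -/x -/y !(mulr0, mul0r, mulr1, oppr0, addr0, subr0, mul1r).
    rewrite expR0 !mulNr cosN sinN /w; ring.
  rewrite ler_pM2l ?mulr_gt0 ?expR_gt0//.
  apply: le_trans (cos_ge_quadratic _).
  have := ler_wpM2l (_ : 0 <= y ^+ 2 / 2) (ln_sqr_le s0).
  rewrite divr_ge0// => /(_ isT); rewrite exprMn; lra.
apply/negP => /eqP z_eq0; move: le_int; rewrite leNgt => /negP; apply.
rewrite (is_cintegral_Re upi) (is_cintegral_Re lowi) z_eq0 mulr0 lte_fin.
rewrite g1 g2 g3 g4 gE -!rmorphM -!rmorphD -rmorphM -rmorphD /=.
set v := (X in 0 < X).
(* In the factor of [y^2 / 2] the terms quadratic in [x] cancel and at most [2 x + 2] remains,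
   against the main term [(x - 1) (x - 2)]. The hypothesis, read as [y^2 <= (x - 6) / 2], then
   decides. *)
have -> : v = g * ((x - 1) * (x - 2) - y ^+ 2 / 2 * ((x - 1) * (x - 2) / x + (x + 2))).
  by rewrite /v; field; rewrite gt_eqF.
rewrite mulr_gt0// subr_gt0.
have h : (x - 1) * (x - 2) / x <= x.
  by rewrite ler_pdivrMr//; nra.
apply: (@le_lt_trans _ _ (y ^+ 2 / 2 * (2 * x + 2))).
  by apply: ler_wpM2l; rewrite ?divr_ge0//; lra.
have : y ^+ 2 * (x + 1) <= (x - 6) / 2 * (x + 1) by rewrite ler_pM2r; lra.
by nra.
Qed.

Lemma cGamma_neq0 (z : R[i]) : 0 < complex.Re z -> cGamma z != 0.
Proof.
move=> z0; apply/negP => /eqP z_eq0.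
have Sn (n : nat) : cGamma (z + n%:R) = 0.
  elim: n => [|n IHn]; first by rewrite addr0.
  rewrite -natr1 addrA cGammaS ?IHn ?mulr0// ReD Re_nat ltr_wpDr//.
(* Adding an integer leaves the imaginary part alone, so the threshold does not move with [n]. *)
pose n := (Num.truncn (2 * complex.Im z ^+ 2 + 6)).+1.
have := @cGamma_neq0_large (z + n%:R).
have -> : complex.Im (z + n%:R) = complex.Im z by rewrite ImD natC /= addr0.
rewrite ReD Re_nat Sn eqxx => /(_ _)/negP; apply => //.
have := truncnS_gt (2 * complex.Im z ^+ 2 + 6); rewrite -/n => h; lra.
Qed.

End gamma_nonvanishing.

(** * Positive definite matrices and Schur complements *)

Section posdef.
Variable R : realType.
Local Notation C := R[i].

Definition qform n (A : 'M[C]_n) (v : 'cV[C]_n) : C := (v^t* *m A *m v) 0 0.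

Lemma adjmxM m n p (A : 'M[C]_(m, n)) (B : 'M[C]_(n, p)) :
  (A *m B)^t* = B^t* *m A^t*.
Proof. by rewrite trmx_mul map_mxM. Qed.

Lemma adjmxK m n (A : 'M[C]_(m, n)) : (A^t*)^t* = A.
Proof. by apply/matrixP => i j; rewrite !mxE conjCK. Qed.

Lemma adjmxD m n (A B : 'M[C]_(m, n)) : (A + B)^t* = A^t* + B^t*.
Proof. by apply/matrixP => i j; rewrite !mxE rmorphD. Qed.

Lemma adjmxZ m n a (A : 'M[C]_(m, n)) : (a *: A)^t* = Num.conj a *: A^t*.
Proof. by apply/matrixP => i j; rewrite !mxE rmorphM. Qed.

Lemma adjmx1 n : (1%:M : 'M[C]_n)^t* = 1%:M.
Proof. by rewrite trmx1 map_mx1. Qed.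

Lemma adjmx0 m n : (0 : 'M[C]_(m, n))^t* = 0.
Proof. by rewrite trmx0 map_mx0. Qed.

Lemma adjmx_block m1 m2 n1 n2 (A : 'M[C]_(m1, n1)) (B : 'M[C]_(m1, n2))
    (D : 'M[C]_(m2, n1)) (E : 'M[C]_(m2, n2)) :
  (block_mx A B D E)^t* = block_mx (A^t*) (D^t*) (B^t*) (E^t*).
Proof. by rewrite tr_block_mx map_block_mx. Qed.

Lemma hermsymmE n (A : 'M[C]_n) : A \is hermsymmx <-> A = A^t*.
Proof.
split; first by move=> /is_hermitianmxP; rewrite expr0 scale1r.
by move=> h; apply/is_hermitianmxP; rewrite expr0 scale1r.
Qed.

Lemma conj_realC (x : R) : Num.conj (x%:C) = x%:C.
Proof. by rewrite conjCE conjc_real. Qed.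

Lemma qform_congr n m (A : 'M[C]_n) (U : 'M[C]_(n, m)) v :
  qform (U^t* *m A *m U) v = qform A (U *m v).
Proof. by rewrite /qform adjmxM !mulmxA. Qed.

Lemma posdefmx_congr n (A U : 'M[C]_n) : U \in unitmx ->
  posdefmx (U^t* *m A *m U) <-> posdefmx A.
Proof.
move=> Uu.
have key (B V : 'M[C]_n) : V \in unitmx -> posdefmx B -> posdefmx (V^t* *m B *m V).
  move=> Vu [/hermsymmE hB pB]; split.
    by apply/hermsymmE; rewrite !adjmxM adjmxK -hB mulmxA.
  move=> v v0; rewrite -/(qform _ _) qform_congr; apply: pB.
  by apply: contra_neq v0 => h; rewrite -(mulKmx Vu v) h mulmx0.
split; last exact: key.
move=> h; have Vu : invmx U \in unitmx by rewrite unitmx_inv.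
have := key _ _ Vu h; rewrite !mulmxA -adjmxM mulmxV// adjmx1 mul1mx.
by rewrite -mulmxA mulmxV// mulmx1.
Qed.

Lemma qformD n (A B : 'M[C]_n) v : qform (A + B) v = qform A v + qform B v.
Proof. by rewrite /qform mulmxDr mulmxDl mxE. Qed.

Lemma qformZ n a (A : 'M[C]_n) v : qform (a *: A) v = a * qform A v.
Proof. by rewrite /qform -scalemxAr -scalemxAl mxE. Qed.

Lemma qform0 n (A : 'M[C]_n) : qform A 0 = 0.
Proof. by rewrite /qform mulmx0 mxE. Qed.

Lemma posdefmxD n (A B : 'M[C]_n) : posdefmx A -> posdefmx B -> posdefmx (A + B).
Proof.
move=> [/hermsymmE hA pA] [/hermsymmE hB pB]; split.
  by apply/hermsymmE; rewrite adjmxD -hA -hB.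
by move=> v v0; rewrite -/(qform _ _) qformD addr_gt0// ?pA ?pB.
Qed.

Lemma posdefmxZ n (x : R) (A : 'M[C]_n) : 0 < x -> posdefmx A ->
  posdefmx (x%:C *: A).
Proof.
move=> x0 [/hermsymmE hA pA]; split.
  by apply/hermsymmE; rewrite adjmxZ conj_realC -hA.
by move=> v v0; rewrite -/(qform _ _) qformZ mulr_gt0// ?pA// ltcR.
Qed.

Lemma qform1 n (v : 'cV[C]_n) : qform 1%:M v = \sum_i `|v i 0| ^+ 2.
Proof.
rewrite /qform mulmx1 mxE; apply: eq_bigr => i _.
by rewrite !mxE mulrC normCK.
Qed.

Lemma posdefmx1 n : posdefmx (1%:M : 'M[C]_n).
Proof.
split; first by apply/hermsymmE; rewrite adjmx1.
move=> v v0; rewrite -/(qform _ _) qform1.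
have [i vi] : exists i, v i 0 != 0.
  apply/existsP; apply: contraR v0; rewrite negb_exists => /forallP h.
  by apply/eqP/colP => i; have := h i; rewrite negbK mxE => /eqP.
rewrite (bigD1 i)//= ltr_wpDr//; first by rewrite sumr_ge0// => j _; rewrite exprn_ge0.
by rewrite exprn_gt0 ?normr_gt0.
Qed.

Lemma posdefmx_dim0 (A : 'M[C]_0) : posdefmx A.
Proof.
split; first by apply/hermsymmE/matrixP => -[].
by move=> v /eqP; case; apply/colP => -[].
Qed.

Lemma qform_col_mx n (a : C) (A : 'M[C]_n) (u : C) (v : 'cV[C]_n) :
  qform (block_mx a%:M 0 0 A) (col_mx u%:M v) = a * `|u| ^+ 2 + qform A v.
Proof.
rewrite /qform -mulmxA mul_block_col !mul0mx addr0 add0r.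
rewrite tr_col_mx map_row_mx mul_row_col mxE; congr (_ + _); last by rewrite mulmxA.
by rewrite -scalar_mxM tr_scalar_mx map_scalar_mx -scalar_mxM mxE eqxx mulr1n normCK /=; ring.
Qed.

Lemma col_mxE n (v : 'cV[C]_(1 + n)) :
  v = col_mx (v 0 0)%:M (dsubmx v).
Proof.
rewrite -[LHS]vsubmxK; congr col_mx; apply/colP => i.
by rewrite !mxE !ord1 eqxx mulr1n; congr (v _ _); apply/val_inj.
Qed.

Lemma posdefmx_diag n (a : C) (A : 'M[C]_n) :
  posdefmx (block_mx a%:M 0 0 A : 'M[C]_(1 + n)) <-> 0 < a /\ posdefmx A.
Proof.
split.
  move=> [/hermsymmE hA pA].
  have a0 : 0 < a.
    have := pA (col_mx 1%:M 0); rewrite -/(qform _ _) qform_col_mx qform0 addr0.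
    rewrite normr1 expr1n mulr1; apply; apply/eqP => /colP/(_ 0).
    by rewrite !mxE; case: splitP => // j _; rewrite mxE ord1 /= => /eqP; rewrite oner_eq0.
  split => //; split.
    apply/hermsymmE; move: hA; rewrite adjmx_block => /eq_block_mx[_ _ _ h].
    exact: h.
  move=> v v0; have := pA (col_mx 0%:M v).
  rewrite -/(qform _ _) qform_col_mx normr0 expr0n mulr0 add0r; apply.
  by apply: contra_neq v0 => /(congr1 dsubmx); rewrite col_mxKd linear0.
move=> [a0 [/hermsymmE hA pA]]; split.
  apply/hermsymmE; rewrite adjmx_block !adjmx0 -hA tr_scalar_mx map_scalar_mx.
  by rewrite /= (CrealP _)// ger0_real// ltW.
move=> v v0; rewrite -/(qform _ _) (col_mxE v) qform_col_mx.
have [w0|w0] := eqVneq (dsubmx v) 0; last first.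
  by rewrite ltr_wpDl ?mulr_ge0 ?exprn_ge0 ?(ltW a0)//; exact: pA.
rewrite w0 qform0 addr0 mulr_gt0// exprn_gt0// normr_gt0.
apply: contra_neq v0 => u0; rewrite (col_mxE v) w0 u0 raddf0.
by rewrite col_mx0.
Qed.

(** Congruence splitting at the lower right corner: [A] is that block and [a] is its Schur
    complement in the whole matrix. Constant matrices are brought to this form. *)
Lemma schur_factor n (a : C) (w : 'cV[C]_n) (A : 'M[C]_n) :
  (block_mx 1%:M 0 w 1%:M : 'M[C]_(1 + n))^t* *m
    block_mx a%:M 0 0 A *m block_mx 1%:M 0 w 1%:M =
  block_mx (a%:M + w^t* *m A *m w) (w^t* *m A) (A *m w) A.
Proof.
rewrite adjmx_block !adjmx1 adjmx0 !mulmx_block.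
by rewrite !(mul1mx, mulmx1, mul0mx, mulmx0, addr0, add0r).
Qed.

Lemma schur_unit n (w : 'cV[C]_n) :
  (block_mx 1%:M 0 w 1%:M : 'M[C]_(1 + n)) \in unitmx.
Proof. by rewrite unitmxE det_lblock !det1 mulr1 unitr1. Qed.

Lemma det_schur n (a : C) (w : 'cV[C]_n) (A : 'M[C]_n) :
  \det (block_mx (a%:M + w^t* *m A *m w) (w^t* *m A) (A *m w) A : 'M[C]_(1 + n)) =
  a * \det A.
Proof.
rewrite -schur_factor !det_mulmx det_map_mx det_tr.
have -> : \det (block_mx 1%:M 0 w 1%:M : 'M[C]_(1 + n)) = 1.
  by rewrite det_lblock !det1 mulr1.
by rewrite rmorph1 det_lblock det_scalar1 mulr1 mul1r.
Qed.

Lemma posdefmx_schur n (a : C) (w : 'cV[C]_n) (A : 'M[C]_n) :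
  posdefmx (block_mx (a%:M + w^t* *m A *m w) (w^t* *m A) (A *m w) A : 'M[C]_(1 + n)) <->
  0 < a /\ posdefmx A.
Proof.
rewrite -schur_factor; apply: iff_trans (posdefmx_diag a A).
exact: posdefmx_congr (schur_unit w).
Qed.

(** A nonzero row [r] in the kernel of [A^T] would give [A r^T = 0], and the Hermitian form would
    vanish at [r^T]. *)
Lemma posdefmx_unit n (A : 'M[C]_n) : posdefmx A -> A \in unitmx.
Proof.
move=> [_ pA]; rewrite -unitmx_tr -row_free_unit -kermx_eq0; apply/eqP/row_matrixP => i.
rewrite row0; have /sub_kermxP h := row_sub i (kermx A^T).
set r := row i _ in h *; apply/eqP; apply: contraT => r0.
have := pA r^T; rewrite trmx_eq0 => /(_ r0).
by rewrite -mulmxA -[A *m r^T]trmxK trmx_mul trmxK h trmx0 mulmx0 mxE ltxx.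
Qed.

Lemma posdefmx_drsub n (A : 'M[C]_(1 + n)) : posdefmx A -> posdefmx (drsubmx A).
Proof.
move=> [/hermsymmE hA pA]; split.
  by apply/hermsymmE; rewrite {1}hA -[in LHS](submxK A) adjmx_block block_mxKdr.
move=> v v0; have := pA (col_mx 0 v).
rewrite -{1}(submxK A) -mulmxA mul_block_col !mulmx0 !add0r tr_col_mx map_row_mx.
rewrite mul_row_col adjmx0 mul0mx add0r mulmxA; apply.
by apply: contra_neq v0 => /(congr1 dsubmx); rewrite col_mxKd linear0.
Qed.

Lemma posdefmx_schurP n (A : 'M[C]_(1 + n)) : posdefmx A ->
  exists (s : R) (w : 'cV[C]_n) (B : 'M[C]_n), [/\ 0 < s, posdefmx B &
    A = block_mx (s%:C%:M + w^t* *m B *m w) (w^t* *m B) (B *m w) B].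
Proof.
move=> pA; have [/hermsymmE hA _] := pA.
have pB := posdefmx_drsub pA; set B := drsubmx A in pB.
have Bu := posdefmx_unit pB.
pose w := invmx B *m dlsubmx A.
have Bw : B *m w = dlsubmx A by rewrite mulKVmx.
have wB : w^t* *m B = ursubmx A.
  have [/hermsymmE hB _] := pB.
  rewrite [X in _ *m X]hB -adjmxM Bw.
  by rewrite [in RHS]hA -[in RHS](submxK A) adjmx_block block_mxKur.
pose a := (ulsubmx A - w^t* *m B *m w) 0 0.
have AE : A = block_mx (a%:M + w^t* *m B *m w) (w^t* *m B) (B *m w) B.
  by rewrite wB Bw -[LHS]submxK /a -mx11_scalar wB subrK.
have [a0 _] : 0 < a /\ posdefmx B by apply/(posdefmx_schur a w B); rewrite -AE.
exists (complex.Re a), w, B.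
(* In the order of [R[i]] a positive number is real, which turns the Schur complement into a real
   [s]. *)
have aE : (complex.Re a)%:C = a by rewrite RRe_real// ger0_real// ltW.
by split => //; [rewrite -ltcR aE|rewrite aE].
Qed.

Lemma posdefmx_det_gt0 n (A : 'M[C]_n) : posdefmx A -> 0 < \det A.
Proof.
elim: n A => [|n IHn] A pA; first by rewrite det_mx00.
have [s [w [B [s0 pB ->]]]] := @posdefmx_schurP n A pA.
by rewrite det_schur mulr_gt0 ?IHn// ltcR.
Qed.

Lemma absdet_gt0 n (A : 'M[C]_n) : posdefmx A -> 0 < absdet A.
Proof.
move=> /posdefmx_det_gt0 d0; rewrite /absdet lt_neqAle normc_ge0 andbT eq_sym.
by apply: contraTneq d0 => /Normc.eq0_normc ->; rewrite ltxx.
Qed.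

Lemma absdet_schur n (s : R) (w : 'cV[C]_n) (B : 'M[C]_n) : 0 <= s ->
  absdet (block_mx (s%:C%:M + w^t* *m B *m w) (w^t* *m B) (B *m w) B : 'M[C]_(1 + n)) =
  s * absdet B.
Proof. by move=> s0; rewrite /absdet det_schur Normc.normcM normc_real ger0_norm. Qed.

Lemma absdetZ n (x : R) (A : 'M[C]_n) : 0 <= x -> absdet (x%:C *: A) = x ^+ n * absdet A.
Proof.
move=> x0; rewrite /absdet detZ Normc.normcM -rmorphXn normc_real.
by rewrite ger0_norm// exprn_ge0.
Qed.

(** Coordinates for the variable matrix, split at its upper left entry: [Y] is the Schur complement
    of [x]. The constant matrix is split at the opposite corner, for the sake of [mxtrace_schur]. *)
Definition schur_mx n (x : R) (v : 'cV[C]_n) (Y : 'M[C]_n) : 'M[C]_(1 + n) :=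
  block_mx x%:C%:M (v^t*) v (Y + (x^-1)%:C *: (v *m v^t*)).

Lemma schur_mxE n (x : R) (v : 'cV[C]_n) (Y : 'M[C]_n) : x != 0 ->
  let U : 'M[C]_(1 + n) := block_mx 1%:M ((x^-1)%:C *: v^t*) 0 1%:M in
  schur_mx x v Y = U^t* *m block_mx x%:C%:M 0 0 Y *m U.
Proof.
move=> x0 /=; rewrite /schur_mx adjmx_block !adjmx1 adjmx0 adjmxZ adjmxK conj_realC !mulmx_block.
rewrite !(mul1mx, mulmx1, mul0mx, mulmx0, addr0, add0r).
rewrite mul_scalar_mx scalerA -rmorphM mulfV// scale1r.
have -> : ((x^-1)%:C *: v) *m x%:C%:M = v.
  by rewrite mul_mx_scalar scalerA -rmorphM mulfV// scale1r.
by rewrite -scalemxAr addrC.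
Qed.

Lemma schur_mx_unit n (x : R) (v : 'cV[C]_n) :
  (block_mx 1%:M ((x^-1)%:C *: v^t*) 0 1%:M : 'M[C]_(1 + n)) \in unitmx.
Proof. by rewrite unitmxE det_ublock !det1 mulr1 unitr1. Qed.

Lemma posdefmx_schur_mx n (x : R) (v : 'cV[C]_n) (Y : 'M[C]_n) :
  posdefmx (schur_mx x v Y) <-> 0 < x /\ posdefmx Y.
Proof.
have key : 0 < x -> posdefmx (schur_mx x v Y) <-> posdefmx Y.
  move=> x0; rewrite schur_mxE ?gt_eqF//.
  apply: iff_trans (posdefmx_congr _ (schur_mx_unit x v)) _.
  apply: iff_trans (posdefmx_diag _ _) _.
  by split; [case|split => //; rewrite ltcR].
split; last by move=> [x0 ?]; apply/key.
(* The sign of [x] is still unknown, so [key] cannot be applied yet; testing the form at the first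
   basis vector gives [x] itself. *)
move=> h; have x0 : 0 < x; last by split => //; apply/key.
have [_ /(_ (col_mx 1%:M 0))] := h.
rewrite -mulmxA mul_block_col !mulmx0 !addr0 !mulmx1 tr_col_mx map_row_mx.
rewrite mul_row_col adjmx0 mul0mx addr0 adjmx1 mul1mx mxE eqxx mulr1n ltcR; apply.
apply/eqP => /colP/(_ 0); rewrite !mxE; case: splitP => // j _.
by rewrite mxE ord1 /= => /eqP; rewrite oner_eq0.
Qed.

Lemma absdet_schur_mx n (x : R) (v : 'cV[C]_n) (Y : 'M[C]_n) : 0 < x ->
  absdet (schur_mx x v Y) = x * absdet Y.
Proof.
move=> x0; rewrite schur_mxE ?gt_eqF// /absdet !det_mulmx det_map_mx det_tr.
have -> : \det (block_mx 1%:M ((x^-1)%:C *: v^t*) 0 1%:M : 'M[C]_(1 + n)) = 1.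
  by rewrite det_ublock !det1 mulr1.
by rewrite rmorph1 det_lblock det_scalar1 mulr1 mul1r Normc.normcM normc_real gtr0_norm.
Qed.

(** Completing the square: the form of [B / x] at [v + x w] collects the contribution of the outer
    product in [schur_mx], the two cross terms and [x w^* B w]. No term couples [Y] with [x] or [v],
    because the two matrices are split at opposite corners. *)
Lemma mxtrace_schur n (s x : R) (v w : 'cV[C]_n) (Y B : 'M[C]_n) : 0 < x ->
  \tr ((block_mx (s%:C%:M + w^t* *m B *m w) (w^t* *m B) (B *m w) B : 'M[C]_(1 + n)) *m
     schur_mx x v Y) =
  (s * x)%:C + qform ((x^-1)%:C *: B) (v + x%:C *: w) + \tr (B *m Y).
Proof.
move=> x0; rewrite /schur_mx mulmx_block mxtrace_block.
rewrite !mxtraceD trace_mx11 mul_mx_scalar mxE mxE [in X in _ * X]mxE eqxx mulr1n.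
rewrite trace_mx11 mulmxDr mxtraceD -scalemxAr mxtraceZ.
have trE (u : 'cV[C]_n) : \tr (B *m u *m v^t*) = (v^t* *m B *m u) 0 0.
  by rewrite mxtrace_mulC mulmxA trace_mx11.
rewrite trE mulmxA trE qformZ /qform adjmxD adjmxZ conj_realC !mulmxDl !mulmxDr.
rewrite -!scalemxAl -!scalemxAr !scalerA !mxE.
rewrite rmorphM fmorphV /=.
field; by rewrite eq_complex /= eqxx andbT gt_eqF.
Qed.

Lemma qform_schur n (s : R) (w v : 'cV[C]_n) (B : 'M[C]_n) (u : C) :
  qform (block_mx (s%:C%:M + w^t* *m B *m w) (w^t* *m B) (B *m w) B : 'M[C]_(1 + n))
    (col_mx u%:M v) = s%:C * `|u| ^+ 2 + qform B (u *: w + v).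
Proof.
rewrite -schur_factor qform_congr mul_block_col !mul1mx mul0mx addr0.
by rewrite mul_mx_scalar qform_col_mx.
Qed.

(** By cyclicity the trace is its own conjugate. Hence [exp (- tr (A X))] equals its own modulus, as
    the domination arguments require. *)
Lemma mxtrace_herm_real n (A X : 'M[C]_n) : A \is hermsymmx -> X \is hermsymmx ->
  complex.Im (\tr (A *m X)) = 0.
Proof.
move=> /hermsymmE hA /hermsymmE hX.
have h : Num.conj (\tr (A *m X)) = \tr (A *m X).
  rewrite {1}mxtrace_mulC -mxtrace_tr /mxtrace rmorph_sum; apply: eq_bigr => i _.
  have -> : A *m X = (X *m A)^t* by rewrite adjmxM -hA -hX.
  by rewrite !mxE.
move: h; rewrite conjCE; case: (\tr _) => a b /= [] /eqP.
by rewrite eq_sym -subr_eq0 opprK -mulr2n mulrn_eq0 => /eqP.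
Qed.

Lemma qform_ge0 n (A : 'M[C]_n) v : posdefmx A -> 0 <= qform A v.
Proof.
move=> [_ pA]; have [->|v0] := eqVneq v 0; first by rewrite qform0.
exact/ltW/pA.
Qed.

End posdef.

(** * Real coordinates of Hermitian matrices *)

Section mxmeasurable.
Context d (T : measurableType d) (R : realType).
Local Notation C := R[i].

Definition mxmeasurable m n (M : T -> 'M[C]_(m, n)) :=
  forall i j, cmeasurable (fun x => M x i j).

Lemma mxmeasurable_cst m n (M : 'M[C]_(m, n)) : mxmeasurable (fun=> M).
Proof. by move=> i j; exact: cmeasurable_cst. Qed.

Lemma mxmeasurableD m n (M N : T -> 'M[C]_(m, n)) :
  mxmeasurable M -> mxmeasurable N -> mxmeasurable (fun x => M x + N x).
Proof. by move=> mM mN i j; under eq_fun do rewrite mxE; exact: cmeasurableD. Qed.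

Lemma mxmeasurableN m n (M : T -> 'M[C]_(m, n)) :
  mxmeasurable M -> mxmeasurable (fun x => - M x).
Proof. by move=> mM i j; under eq_fun do rewrite mxE; exact: cmeasurableN. Qed.

Lemma mxmeasurableZ m n (f : T -> C) (M : T -> 'M[C]_(m, n)) :
  cmeasurable f -> mxmeasurable M -> mxmeasurable (fun x => f x *: M x).
Proof. by move=> mf mM i j; under eq_fun do rewrite mxE; exact: cmeasurableM. Qed.

Lemma mxmeasurableM m n p (M : T -> 'M[C]_(m, n)) (N : T -> 'M[C]_(n, p)) :
  mxmeasurable M -> mxmeasurable N -> mxmeasurable (fun x => M x *m N x).
Proof.
move=> mM mN i j; under eq_fun do rewrite mxE.
by apply: cmeasurable_sum => l; exact: cmeasurableM.
Qed.

Lemma mxmeasurable_adj m n (M : T -> 'M[C]_(m, n)) :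
  mxmeasurable M -> mxmeasurable (fun x => (M x)^t*).
Proof.
move=> mM i j; under eq_fun do rewrite mxE mxE; exact: cmeasurable_conj.
Qed.

Lemma mxmeasurable_scalar n (f : T -> C) :
  cmeasurable f -> mxmeasurable (fun x => (f x)%:M : 'M[C]_n).
Proof.
move=> mf i j; under eq_fun do rewrite mxE.
by case: (i == j) => /=; [|exact: cmeasurable_cst].
Qed.

Lemma mxmeasurable_block m1 m2 n1 n2 (A : T -> 'M[C]_(m1, n1)) (B : T -> 'M[C]_(m1, n2))
    (D : T -> 'M[C]_(m2, n1)) (E : T -> 'M[C]_(m2, n2)) :
  mxmeasurable A -> mxmeasurable B -> mxmeasurable D -> mxmeasurable E ->
  mxmeasurable (fun x => block_mx (A x) (B x) (D x) (E x)).
Proof.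
move=> mA mB mD mE a b.
rewrite -[a]splitK -[b]splitK; case: (fintype.split a) => {}a; case: (fintype.split b) => {}b /=.
- by under eq_fun do rewrite block_mxEul.
- by under eq_fun do rewrite block_mxEur.
- by under eq_fun do rewrite block_mxEdl.
- by under eq_fun do rewrite block_mxEdr.
Qed.

Lemma cmeasurable_trace n (M : T -> 'M[C]_n) :
  mxmeasurable M -> cmeasurable (fun x => \tr (M x)).
Proof. by move=> mM; apply: cmeasurable_sum => i; exact: mM. Qed.

Lemma cmeasurable_det n (M : T -> 'M[C]_n) :
  mxmeasurable M -> cmeasurable (fun x => \det (M x)).
Proof.
move=> mM; apply: cmeasurable_sum => s; apply: cmeasurableM.
  exact: cmeasurable_cst.
by apply: cmeasurable_prod => i; exact: mM.
Qed.

Lemma measurable_absdet n (M : T -> 'M[C]_n) :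
  mxmeasurable M -> measurable_fun setT (fun x => absdet (M x)).
Proof. by move=> mM; apply: measurable_normc; exact: cmeasurable_det. Qed.

Lemma cmeasurable_qform n (A : T -> 'M[C]_n) (v : T -> 'cV[C]_n) :
  mxmeasurable A -> mxmeasurable v -> cmeasurable (fun x => qform (A x) (v x)).
Proof.
move=> mA mv; have h := mxmeasurableM (mxmeasurableM (mxmeasurable_adj mv) mA) mv.
exact: h.
Qed.

End mxmeasurable.

Section herm_coordinates.
Variable R : realType.
Local Notation C := R[i].
Local Notation L := (measurableTypeR R).
Local Notation Rn n := (n.-tuple L).

Definition herm_coords p (M : 'M[C]_p) : Rn (p * p) :=
  let c : 'M[R]_p := \matrix_(i, j)
    (if (i <= j)%N then complex.Re (M i j) else complex.Im (M j i)) in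
  [tuple (mxvec c 0 l : L) | l < p * p].

Lemma tnth_herm_coords p (M : 'M[C]_p) i j :
  tnth (herm_coords M) (mxvec_index i j) =
  if (i <= j)%N then complex.Re (M i j) else complex.Im (M j i).
Proof. by rewrite tnth_mktuple mxvecE mxE. Qed.

Lemma herm_mx_hermsymm p (t : Rn (p * p)) : herm_mx t \is hermsymmx.
Proof.
apply/hermsymmE/matrixP => i j; rewrite !mxE conjCE.
by case: ltngtP => //= ij; rewrite ?opprK// (ord_inj ij) oppr0.
Qed.

Lemma herm_coordsK p (M : 'M[C]_p) : M \is hermsymmx -> herm_mx (herm_coords M) = M.
Proof.
move=> /hermsymmE hM; apply/matrixP => i j; rewrite !mxE !tnth_herm_coords.
have h k l : M k l = conjc (M l k) by rewrite {1}hM !mxE conjCE.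
case: ltngtP => ij.
- by case: (M i j).
- by rewrite [RHS]h; case: (M j i).
- rewrite (ord_inj ij) leqnn; have := h j j; case: (M j j) => a b [] /eqP.
  by rewrite -subr_eq0 opprK -mulr2n mulrn_eq0 /= => /eqP ->.
Qed.

Lemma herm_mx_tadd p (t u : Rn (p * p)) : herm_mx (tadd t u) = herm_mx t + herm_mx u.
Proof.
apply/matrixP => i j; rewrite !mxE !tnth_mktuple.
case: ltngtP => // _; apply/eqP; rewrite eq_complex ReD ImD /=.
- by rewrite eqxx /= (@opprD R) eqxx.
- by rewrite eqxx /= (@addr0 R) eqxx.
Qed.

Lemma mxmeasurable_herm d (T : measurableType d) p (f : T -> Rn (p * p)) :
  measurable_fun setT f -> mxmeasurable (fun x => herm_mx (f x)).
Proof.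
move=> /measurable_fun_tnthP mf i j; under eq_fun do rewrite mxE.
have m' l : measurable_fun setT (fun x => tnth (f x) l : R) by exact: mf.
case: ltngtP => _.
- by apply: cmeasurable_Complex; exact: m'.
- by apply: cmeasurable_Complex; [exact: m'|apply: measurableT_comp => //; exact: m'].
- by apply: cmeasurable_real; exact: m'.
Qed.

Lemma measurable_herm_coords d (T : measurableType d) p (M : T -> 'M[C]_p) :
  mxmeasurable M -> measurable_fun setT (fun x => herm_coords (M x)).
Proof.
move=> mM; apply/measurable_fun_tnthP => l; case/mxvec_indexP: l => i j.
rewrite (_ : _ \o _ = fun x => (if (i <= j)%N then complex.Re (M x i j) else complex.Im (M x j i)) : L).
  by case: (i <= j)%N; [exact: (mM i j).1|exact: (mM j i).2].
by apply/funext => x /=; rewrite tnth_herm_coords.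
Qed.

(* The conjugate makes the coordinates of [v], read in order, those of the first
   row and column of a Hermitian matrix whose first column is [v]. *)
Definition cvec k (t : Rn k.*2) : 'cV[C]_k :=
  \col_j (nth 0 t j.*2 -i* nth 0 t j.*2.+1).

Lemma measurable_nth d (T : measurableType d) n (f : T -> Rn n) l :
  measurable_fun setT f -> measurable_fun setT (fun x => nth (0 : R) (f x) l : R).
Proof.
move=> /measurable_fun_tnthP mf; have [ln|ln] := ltnP l n.
  rewrite (_ : (fun _ => _) = fun x => tnth (f x) (Ordinal ln) : R); first exact: mf.
  by apply/funext => x; rewrite (tnth_nth 0).
rewrite (_ : (fun _ => _) = fun=> 0); first exact: measurable_cst.
by apply/funext => x; rewrite nth_default// size_tuple.
Qed.

Lemma mxmeasurable_cvec d (T : measurableType d) k (f : T -> Rn k.*2) :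
  measurable_fun setT f -> mxmeasurable (fun x => cvec (f x)).
Proof.
move=> mf i j; under eq_fun do rewrite mxE.
apply: cmeasurable_Complex; first exact: measurable_nth.
by apply: measurableT_comp => //; exact: measurable_nth.
Qed.

End herm_coordinates.

(** * Splitting off the first row and column *)

Section border.
Variable R : realType.
Local Notation C := R[i].
Local Notation L := (measurableTypeR R).
Local Notation Rn n := (n.-tuple L).
Local Notation leb := (lebesgue_tuple R).

Definition posdef_set p : set (Rn (p * p)) := [set t | posdefmx (herm_mx t)].
Arguments posdef_set : clear implicits.

Definition border k (x : R) (v : 'cV[C]_k) (Y : 'M[C]_k) : 'M[C]_(1 + k) :=
  block_mx x%:C%:M (v^t*) v Y.

Lemma border_hermsymm k x (v : 'cV[C]_k) (Y : 'M[C]_k) : Y \is hermsymmx ->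
  border x v Y \is hermsymmx.
Proof.
move=> /hermsymmE hY; apply/hermsymmE; rewrite adjmx_block adjmxK -hY.
by rewrite tr_scalar_mx map_scalar_mx /= conj_realC.
Qed.

Lemma outer_hermsymm k (x : R) (v : 'cV[C]_k) : x%:C *: (v *m v^t*) \is hermsymmx.
Proof. by apply/hermsymmE; rewrite adjmxZ conj_realC adjmxM adjmxK. Qed.

Lemma mxmeasurable_border d (T : measurableType d) k (x : T -> R)
    (v : T -> 'cV[C]_k) (Y : T -> 'M[C]_k) :
  measurable_fun setT x -> mxmeasurable v -> mxmeasurable Y ->
  mxmeasurable (fun t => border (x t) (v t) (Y t)).
Proof.
move=> mx mv mY; apply: mxmeasurable_block => //.
  by apply: mxmeasurable_scalar; exact: cmeasurable_real.
exact: mxmeasurable_adj.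
Qed.

(** [x^-1 = x (x^2)^-1], where the base [x^2] of the real power is nonnegative; at [x = 0] both
    sides are 0. *)
Lemma measurable_invr d (T : measurableType d) (f : T -> R) :
  measurable_fun setT f -> measurable_fun setT (fun x => (f x)^-1).
Proof.
move=> mf.
rewrite (_ : (fun _ => _) = fun x => f x * (f x ^+ 2) `^ (-1)).
  apply: measurable_funM => //.
  exact: (measurableT_comp (@measurable_powR R (-1)) (measurable_funX 2 mf)).
apply/funext => x; rewrite powR_inv1 ?sqr_ge0//.
by have [->|x0] := eqVneq (f x) 0; [rewrite invr0 mul0r|field].
Qed.

Lemma measurable_outer d (T : measurableType d) k (x : T -> R) (v : T -> 'cV[C]_k) :
  measurable_fun setT x -> mxmeasurable v ->
  mxmeasurable (fun t => ((x t)^-1)%:C *: (v t *m (v t)^t*)).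
Proof.
move=> mx mv; apply: mxmeasurableZ.
  by apply: cmeasurable_real; exact: measurable_invr.
by apply: mxmeasurableM => //; exact: mxmeasurable_adj.
Qed.

Lemma schur_mx_border k x (v : 'cV[C]_k) (Y : 'M[C]_k) :
  border x v Y = schur_mx x v (Y - (x^-1)%:C *: (v *m v^t*)).
Proof. by rewrite /schur_mx subrK. Qed.

Lemma herm_border k (M : 'M[C]_(1 + k)) : M \is hermsymmx ->
  drsubmx M \is hermsymmx /\ M = border (complex.Re (M 0 0)) (dlsubmx M) (drsubmx M).
Proof.
move=> /hermsymmE hM; have := hM; rewrite -{1 2}(submxK M) adjmx_block.
move=> /eq_block_mx[hul hur _ hdr]; split; first exact/hermsymmE.
rewrite -[LHS]submxK /border -hur; congr block_mx.
apply/matrixP => i j; rewrite [RHS]mxE !ord1 eqxx mulr1n.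
have /matrixP/(_ 0 0) := hul; rewrite !mxE conjCE.
have -> : lshift k 0 = 0 :> 'I_(1 + k) by exact/val_inj.
case: (M 0 0) => a b [] /eqP.
by rewrite -subr_eq0 opprK -mulr2n mulrn_eq0 /= => /eqP ->.
Qed.

(** By induction on the size, as the set where the corner entry [x] is positive and the Schur
    complement [Y] is positive definite. Inversion being total, [Y] is a measurable function of the
    coordinates everywhere, and [posdefmx_schur_mx] holds for every real [x]. *)
Lemma measurable_posdef p : measurable (posdef_set p).
Proof.
elim: p => [|k IHk].
  rewrite (_ : posdef_set _ = setT)//; apply/seteqP; split => // t _.
  exact: posdefmx_dim0.
pose M (t : Rn (k.+1 * k.+1)) : 'M[C]_(1 + k) := herm_mx t.
pose x t : R := complex.Re (M t 0 0).
pose v t := dlsubmx (M t).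
pose Y t := drsubmx (M t) - ((x t)^-1)%:C *: (v t *m (v t)^t*).
have mM : mxmeasurable M by exact: (mxmeasurable_herm (@measurable_id _ _ _)).
have mx : measurable_fun setT x by exact: (mM 0 0).1.
have mv : mxmeasurable v by move=> i j; under eq_fun do rewrite mxE mxE; exact: mM.
have mY : mxmeasurable Y.
  apply: mxmeasurableD; last by apply: mxmeasurableN; exact: measurable_outer.
  by move=> i j; under eq_fun do rewrite mxE mxE; exact: mM.
have hM t : M t \is hermsymmx by exact: herm_mx_hermsymm.
have ME t : M t = border (x t) (v t) (drsubmx (M t)) := (herm_border (hM t)).2.
have hY t : Y t \is hermsymmx.
  have [/hermsymmE hD _] := herm_border (hM t).
  have /hermsymmE hO := outer_hermsymm ((x t)^-1) (v t).
  by apply/hermsymmE; rewrite /Y adjmxD -hD raddfN /= map_mxN -hO.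
rewrite (_ : posdef_set k.+1 =
    [set t | 0 < x t] `&` (fun t => herm_coords (Y t)) @^-1` posdef_set k).
  apply: measurableI.
    have := mx measurableT `]0, +oo[%classic (measurable_itv _).
    by rewrite setTI; congr measurable; apply/seteqP; split => t /=;
      rewrite in_itv/= andbT.
  rewrite -[X in measurable X]setTI; apply: measurable_herm_coords => //.
apply/seteqP; split => t; rewrite /posdef_set /= herm_coordsK//.
  by rewrite -/(M t) ME schur_mx_border => /posdefmx_schur_mx.
by move=> h; rewrite -/(M t) ME schur_mx_border; exact/posdefmx_schur_mx.
Qed.

Definition behead_tuple n (u : Rn n.+1) : Rn n := [tuple of behead u].

(** The [2 k + 1] reals of [z.1] are the corner entry followed by the interleaved real and imaginary
    parts of the rest of the first row. *)
Definition border_coords k (z : Rn k.*2.+1 * Rn (k * k)) : Rn (k.+1 * k.+1) :=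
  herm_coords (border (thead z.1) (cvec (behead_tuple z.1)) (herm_mx z.2)).

Lemma measurable_thead n : measurable_fun setT (fun u : Rn n.+1 => thead u : R).
Proof. exact: measurable_tnth. Qed.

Lemma measurable_behead_tuple n : measurable_fun setT (@behead_tuple n).
Proof. exact: measurable_behead. Qed.

Lemma measurable_border_coords k : measurable_fun setT (@border_coords k).
Proof.
apply: measurable_herm_coords; apply: mxmeasurable_border.
- exact: (measurableT_comp (@measurable_thead _) measurable_fst).
- apply: mxmeasurable_cvec.
  exact: (measurableT_comp (@measurable_behead_tuple _) measurable_fst).
- by apply: mxmeasurable_herm; exact: measurable_snd.
Qed.

(** [border_coords] permutes coordinates without a change of sign, so that preimages of boxes are
    products of boxes. *)
Lemma tnth_border_coords k z :
  [/\ tnth (@border_coords k z) (mxvec_index ord0 ord0) = nth 0 z.1 0,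
   forall j, tnth (border_coords z) (mxvec_index ord0 (lift ord0 j)) = nth 0 z.1 j.*2.+1,
   forall j, tnth (border_coords z) (mxvec_index (lift ord0 j) ord0) = nth 0 z.1 j.*2.+2 &
   forall i j, tnth (border_coords z) (mxvec_index (lift ord0 i) (lift ord0 j)) =
     tnth z.2 (mxvec_index i j)].
Proof.
pose M : 'M[C]_(1 + k) := border (thead z.1) (cvec (behead_tuple z.1)) (herm_mx z.2).
have M00 : M ord0 ord0 = (nth 0 z.1 0)%:C.
  transitivity (M (lshift k ord0) (lshift k ord0)).
    by congr (M _ _); exact/val_inj.
  by rewrite block_mxEul mxE eqxx mulr1n /thead (tnth_nth 0).
have M0 j : M ord0 (lift ord0 j) = nth 0 z.1 j.*2.+1 +i* nth 0 z.1 j.*2.+2.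
  transitivity (M (lshift k ord0) (rshift 1 j)).
    by congr (M _ _); exact/val_inj.
  by rewrite block_mxEur !mxE conjCE /= opprK !nth_behead.
have MS i j : M (lift ord0 i) (lift ord0 j) = herm_mx z.2 i j.
  transitivity (M (rshift 1 i) (rshift 1 j)).
    by congr (M _ _); exact/val_inj.
  by rewrite block_mxEdr.
split => [|j|j|i j]; rewrite tnth_herm_coords -/M.
- exact: (congr1 (@complex.Re R) M00).
- exact: (congr1 (@complex.Re R) (M0 j)).
- exact: (congr1 (@complex.Im R) (M0 j)).
transitivity (if (i <= j)%N then complex.Re (herm_mx z.2 i j)
  else complex.Im (herm_mx z.2 j i)).
  have -> : (lift ord0 i <= lift ord0 j)%N = (i <= j)%N by [].
  by rewrite -!MS.
by rewrite !mxE; case: ltngtP => // /ord_inj ->.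
Qed.

Lemma prod_mxvec m n (F : 'I_(m * n) -> \bar R) :
  (\prod_l F l = \prod_i \prod_j F (mxvec_index i j))%E.
Proof.
rewrite (reindex _ (curry_mxvec_bij m n)) /= pair_bigA /=.
by apply: eq_bigr => -[i j].
Qed.

Lemma prod_double k (F : nat -> \bar R) :
  (\prod_(l < k.*2) F l = (\prod_(j < k) F j.*2) * \prod_(j < k) F j.*2.+1)%E.
Proof.
elim: k => [|k IHk]; first by rewrite !big_ord0 mule1.
rewrite doubleS !big_ord_recr /= IHk !muleA; congr (_ * _)%E.
by rewrite muleAC.
Qed.

Local Notation nu k := (leb k.*2.+1 \x leb (k * k))%E.

(** It is enough to compare on boxes, where both sides are products of the same lengths, grouped on
    the right by corner, first row, first column and remaining block. *)
Lemma border_coords_measure k (A : set (Rn (k.+1 * k.+1))) : measurable A ->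
  leb (k.+1 * k.+1) A = nu k (@border_coords k @^-1` A).
Proof.
have mb := @measurable_border_coords k.
pose m : {measure set _ -> \bar R} := pushforward (nu k) (@border_coords k).
move=> mA; rewrite -[RHS]/(m mb A).
apply: lebesgue_tuple_unique mA => B mB; rewrite /= /pushforward.
(* After the corner, even places hold real parts, stored in row 0, and odd places imaginary parts,
   stored in column 0. *)
pose Bv (l : nat) : set L := if odd l then B (mxvec_index (inord (l./2).+1) ord0)
  else B (mxvec_index ord0 (inord (l./2).+1)).
pose Bu (l : nat) : set L := if l is l'.+1 then Bv l' else B (mxvec_index ord0 ord0).
have mBu l : measurable (Bu l) by rewrite /Bu /Bv; case: l => // l; case: ifP.
have iS (j : 'I_k) : inord j.+1 = lift ord0 j.
  by apply/val_inj; rewrite /= inordK// ltnS.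
have Bve (j : 'I_k) : Bv j.*2 = B (mxvec_index ord0 (lift ord0 j)).
  by rewrite /Bv odd_double doubleK iS.
have Bvo (j : 'I_k) : Bv j.*2.+1 = B (mxvec_index (lift ord0 j) ord0).
  by rewrite /Bv /= odd_double /= uphalf_double iS.
pose dec (l : 'I_(k * k)) : 'I_k * 'I_k := enum_val (cast_ord (esym (mxvec_cast k k)) l).
have decE i j : dec (mxvec_index i j) = (i, j) by rewrite /dec cast_ordK enum_rankK.
pose Bt (l : 'I_(k * k)) := B (mxvec_index (lift ord0 (dec l).1) (lift ord0 (dec l).2)).
rewrite (_ : _ @^-1` _ = box (fun l : 'I_k.*2.+1 => Bu l) `*` box Bt); last first.
  apply/seteqP; split => z /=; have [e1 e2 e3 e4] := tnth_border_coords z.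
    move=> h; split.
    - move=> -[[|l] ll]; rewrite (tnth_nth 0) /=.
        by have := h (mxvec_index ord0 ord0); rewrite e1.
      have lk : (l./2 < k)%N by rewrite ltn_half_double.
      have lE : l = (odd l + l./2.*2)%N :> nat by rewrite odd_double_half.
      rewrite lE; case: (odd l) => /=; rewrite ?add1n ?add0n.
        by have := h (mxvec_index (lift ord0 (Ordinal lk)) ord0); rewrite e3 -Bvo.
      by have := h (mxvec_index ord0 (lift ord0 (Ordinal lk))); rewrite e2 -Bve.
    - move=> l; case/mxvec_indexP: l => i j; rewrite /Bt decE -e4; exact: h.
  move=> [h1 h3] l; case/mxvec_indexP: l => a b.
  case: (unliftP ord0 a) => [a'|] ->; case: (unliftP ord0 b) => [b'|] ->.
  - by rewrite e4; have := h3 (mxvec_index a' b'); rewrite /Bt decE.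
  - have lk : (a'.*2.+2 < k.*2.+1)%N by rewrite ltnS -doubleS leq_double.
    by rewrite e3 -Bvo; have := h1 (Ordinal lk); rewrite (tnth_nth 0).
  - have lk : (b'.*2.+1 < k.*2.+1)%N by rewrite ltnS ltn_double.
    by rewrite e2 -Bve; have := h1 (Ordinal lk); rewrite (tnth_nth 0).
  - by rewrite e1; have := h1 ord0; rewrite (tnth_nth 0).
have mv : measurable (box (fun l : 'I_k.*2.+1 => Bu l)) by exact: measurable_box.
have mt : measurable (box Bt) by apply: measurable_box => l; exact: mB.
have e1 : nu k (box (fun l : 'I_k.*2.+1 => Bu l) `*` box Bt) =
    (leb k.*2.+1 (box (fun l : 'I_k.*2.+1 => Bu l)) * leb (k * k) (box Bt))%E.
  exact: product_measure1E.
rewrite e1; have -> := lebesgue_tuple_box (fun l : 'I_k.*2.+1 => mBu l).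
have -> := lebesgue_tuple_box (fun l => mB _ : measurable (Bt l)).
rewrite big_ord_recl -[(\prod_(l < k.*2) _)%E]/(\prod_(l < k.*2) lebesgue_measure (Bv l))%E.
have -> : (\prod_(l < k.*2) lebesgue_measure (Bv l) =
    (\prod_(j < k) lebesgue_measure (B (mxvec_index ord0 (lift ord0 j)))) *
    \prod_(j < k) lebesgue_measure (B (mxvec_index (lift ord0 j) ord0)))%E.
  rewrite (prod_double k (fun l => lebesgue_measure (Bv l))).
  by congr (_ * _)%E; apply: eq_bigr => l _; rewrite ?Bve ?Bvo.
have -> : (\prod_(l < k * k) lebesgue_measure (Bt l) = \prod_(i < k) \prod_(j < k)
    lebesgue_measure (B (mxvec_index (lift ord0 i) (lift ord0 j))))%E.
  rewrite prod_mxvec; apply: eq_bigr => a _; apply: eq_bigr => b _.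
  by rewrite /Bt decE.
rewrite [RHS]prod_mxvec [RHS]big_ord_recl.
rewrite [X in _ = (X * _)%E]big_ord_recl.
under [X in _ = (_ * X)%E]eq_bigr do rewrite big_ord_recl.
by rewrite [X in _ = (_ * X)%E]big_split /= !muleA.
Qed.

End border.
Arguments posdef_set : clear implicits.

(** * Gaussian and matrix gamma integrals *)

Section schur_coordinates.
Variable R : realType.
Local Notation C := R[i].
Local Notation L := (measurableTypeR R).
Local Notation Rn n := (n.-tuple L).
Local Notation leb := (lebesgue_tuple R).

Definition schur_coords k (z : Rn k.*2.+1 * Rn (k * k)) : Rn (k.+1 * k.+1) :=
  herm_coords (schur_mx (thead z.1) (cvec (behead_tuple z.1)) (herm_mx z.2)).

Lemma hermsymmD k (A B : 'M[C]_k) : A \is hermsymmx -> B \is hermsymmx ->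
  A + B \is hermsymmx.
Proof.
by move=> /hermsymmE hA /hermsymmE hB; apply/hermsymmE; rewrite adjmxD -hA -hB.
Qed.

Lemma herm_mx_schur_coords k z :
  herm_mx (@schur_coords k z) =
  schur_mx (thead z.1) (cvec (behead_tuple z.1)) (herm_mx z.2).
Proof.
apply: herm_coordsK; apply: border_hermsymm; apply: hermsymmD.
  exact: herm_mx_hermsymm.
exact: outer_hermsymm.
Qed.

Let outer_coords k (a : Rn k.*2.+1) : Rn (k * k) := herm_coords
  (((thead a)^-1)%:C *: (cvec (behead_tuple a) *m (cvec (behead_tuple a))^t*)).

Let measurable_outer_coords k : measurable_fun setT (@outer_coords k).
Proof.
apply: measurable_herm_coords; apply: measurable_outer.
  exact: measurable_thead.
by apply: mxmeasurable_cvec; exact: measurable_behead_tuple.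
Qed.

(** [herm_mx] is additive in the coordinates, so adding [v v^* / x] to [Y] translates its coordinate
    tuple: the map is a shear followed by a permutation of coordinates. *)
Let schur_coordsE k z : schur_coords z = border_coords (shear (@outer_coords k) z).
Proof.
rewrite /schur_coords /border_coords /shear /= herm_mx_tadd herm_coordsK.
  by rewrite addrC.
exact: outer_hermsymm.
Qed.

Lemma is_cintegral_schur_coords k (f : Rn (k.+1 * k.+1) -> C) v : cmeasurable f ->
  is_cintegral (leb k.*2.+1 \x leb (k * k))%E (fun z => f (schur_coords z)) v ->
  is_cintegral (leb (k.+1 * k.+1)) f v.
Proof.
move=> mf fv.
have mfb : cmeasurable (fun z => f (@border_coords R k z)).
  exact: (cmeasurable_comp mf (@measurable_border_coords R k)).
have fE : (fun z => f (schur_coords z)) =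
    (fun z => f (border_coords (shear (@outer_coords k) z))).
  by apply/funext => z; rewrite schur_coordsE.
rewrite fE in fv.
have h := is_cintegral_shear (@measurable_outer_coords k) mfb fv.
exact: (is_cintegral_pushforward (@measurable_border_coords R k)
  (@border_coords_measure R k) mf h).
Qed.

End schur_coordinates.

Section gaussian.
Variable R : realType.
Local Notation C := R[i].
Local Notation L := (measurableTypeR R).
Local Notation Rn n := (n.-tuple L).
Local Notation leb := (lebesgue_tuple R).

(** A right inverse of [cvec], by which adding a complex vector becomes a [tadd] of real tuples. Odd
    places are negated to match the conjugate in [cvec]. *)
Definition cvec_coords k (v : 'cV[C]_k) : Rn k.*2 :=
  let c l := oapp (fun i : 'I_k => v i 0) 0 (insub l) in
  [tuple (if odd l then - complex.Im (c l./2) else complex.Re (c l./2) : L) | l < k.*2].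

Lemma cvec_coordsK k (v : 'cV[C]_k) : cvec (cvec_coords v) = v.
Proof.
apply/colP => j; rewrite mxE.
have l0 : (j.*2 < k.*2)%N by rewrite ltn_double.
have l1 : (j.*2.+1 < k.*2)%N by rewrite -doubleS leq_double.
rewrite -[X in X -i* _](tnth_nth 0 _ (Ordinal l0)) -[X in _ -i* X](tnth_nth 0 _ (Ordinal l1)).
rewrite !tnth_mktuple /= odd_double /= uphalf_double doubleK.
have -> : insub (val j) = Some j by rewrite valK.
by rewrite /= opprK; case: (v j 0).
Qed.

Lemma cvec_tadd k (s t : Rn k.*2) : cvec (tadd s t) = cvec s + cvec t.
Proof.
apply/colP => j; rewrite !mxE.
have l0 : (j.*2 < k.*2)%N by rewrite ltn_double.
have l1 : (j.*2.+1 < k.*2)%N by rewrite -doubleS leq_double.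
have e (u : Rn k.*2) : (nth 0 u j.*2 = tnth u (Ordinal l0)) *
   (nth 0 u j.*2.+1 = tnth u (Ordinal l1)) by rewrite !(tnth_nth 0).
rewrite !e !tnth_mktuple; apply/eqP; rewrite eq_complex ReD ImD /=.
by rewrite (@opprD R) !eqxx.
Qed.

(** Lebesgue measure on tuples of length 0 is the Dirac mass at the empty tuple; this is the base
    case of the inductions on size. *)
Lemma is_cintegral_dim0 (f : Rn 0 -> C) : cmeasurable f ->
  is_cintegral (leb 0) f (f [tuple]).
Proof.
move=> [mf1 mf2].
have e (h : Rn 0 -> \bar R) : measurable_fun setT h ->
    (\int[leb 0]_t h t = h [tuple])%E.
  by move=> mh; rewrite /= integral_dirac// diracT mul1e.
have key (g : Rn 0 -> R) : measurable_fun setT g ->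
    (leb 0).-integrable setT (EFin \o g) /\
    (\int[leb 0]_t (g t)%:E = (g [tuple])%:E)%E.
  move=> mg; have mE : measurable_fun setT (EFin \o g) by exact/measurable_EFinP.
  split; last exact: (e (EFin \o g)).
  apply/integrableP; split => //.
  by rewrite (e (abse \o (EFin \o g))) ?ltry//; exact: measurableT_comp.
have [i1 e1] := key _ mf1; have [i2 e2] := key _ mf2.
exact: is_cintegralP.
Qed.

Lemma is_cintegral_gauss (s : R) : 0 < s ->
  is_cintegral (@lebesgue_measure R) (fun x : L => (expR (- (s * x ^+ 2)))%:C)
    (Num.sqrt (pi / s))%:C.
Proof.
move=> s0; have q0 : 0 < Num.sqrt s by rewrite sqrtr_gt0.
have g1 : is_cintegral (@lebesgue_measure R) (fun x : L => (gauss_fun x)%:C) (Num.sqrt pi)%:C.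
  apply: is_cintegral_real; [exact: measurable_gauss_fun|exact: gauss_fun_ge0|exact: integralT_gauss].
have := is_cintegral_scale q0 g1; rewrite -rmorphM.
rewrite sqrtrM ?pi_ge0// sqrtrV ?(ltW s0)// mulrC; congr is_cintegral.
by apply/funext => x; rewrite /gauss_fun exprMn sqr_sqrtr// ltW.
Qed.

Lemma cvec_cons k (x y : R) (t : Rn k.*2) :
  cvec (cons_pair (x, cons_pair (y, t)) : Rn k.+1.*2) =
  col_mx (x -i* y)%:M (cvec t) :> 'cV[C]_(1 + k).
Proof.
apply/colP => j; rewrite [LHS]mxE; case: (unliftP ord0 j) => [j'|] -> /=.
  transitivity (col_mx (x -i* y)%:M (cvec t) (rshift 1 j') 0).
    by rewrite col_mxEd mxE.
  by congr (col_mx _ _ _ _); exact/val_inj.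
transitivity (col_mx (x -i* y)%:M (cvec t) (lshift k ord0) 0).
  by rewrite col_mxEu mxE eqxx.
by congr (col_mx _ _ _ _); exact/val_inj.
Qed.

(** With [A] split at its lower right block [B], the form is [s |u|^2] plus the form of [B] at [v]
    translated by [u w]. The translation drops out of the integral over [v], and [u], being two real
    coordinates, contributes two Gaussian integrals with product [pi / s]. *)
Lemma is_cintegral_gauss_qform k (A : 'M[C]_k) : posdefmx A ->
  is_cintegral (leb k.*2) (fun t => (expR (- complex.Re (qform A (cvec t))))%:C)
    (pi ^+ k / absdet A)%:C.
Proof.
have mq n (B : 'M[C]_n) : measurable_fun setT
    (fun t : Rn n.*2 => expR (- complex.Re (qform B (cvec t)))).
  apply: measurableT_comp => //; apply: measurableT_comp => //.
  have h : cmeasurable (fun t : Rn n.*2 => qform B (cvec t)).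
    apply: cmeasurable_qform; first exact: mxmeasurable_cst.
    exact: (mxmeasurable_cvec (@measurable_id _ _ _)).
  exact: h.1.
elim: k A => [|k IHk] A pA.
  have h := @is_cintegral_dim0 (fun t : Rn 0.*2 => (expR (- complex.Re (qform A (cvec t))))%:C)
    (cmeasurable_real (mq 0 A)).
  move: h; congr is_cintegral; congr (_%:C).
  rewrite (_ : cvec _ = 0); last by apply/colP => -[].
  by rewrite qform0 oppr0 expR0 /absdet det_mx00 Normc.normc1 divr1.
have [s [w [B [s0 pB AE]]]] := @posdefmx_schurP R k A pA.
have aE : absdet A = s * absdet B by rewrite AE; apply: absdet_schur; exact: ltW.
have aB := absdet_gt0 pB.
pose K := pi ^+ k / absdet B.
pose q := Num.sqrt (pi / s).
have q2 : q * q = pi / s by rewrite -expr2 sqr_sqrtr// divr_ge0 ?pi_ge0 ?ltW.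
pose F (x y : R) (t : Rn k.*2) : R :=
  expR (- complex.Re (qform A (cvec (cons_pair (x, cons_pair (y, t)) : Rn k.+1.*2)))).
have FE x y t : F x y t = expR (- (s * x ^+ 2)) * expR (- (s * y ^+ 2)) *
    expR (- complex.Re (qform B (cvec (tadd (cvec_coords ((x -i* y) *: w)) t)))).
  rewrite /F cvec_cons AE qform_schur cvec_tadd cvec_coordsK -!expRD.
  have -> : `|x -i* y| ^+ 2 = (x ^+ 2 + y ^+ 2)%:C by rewrite -add_Re2_Im2 /= sqrrN.
  by rewrite ReD -rmorphM /=; congr expR; ring.
have I0 x y : is_cintegral (leb k.*2) (fun t => (F x y t)%:C)
    ((expR (- (s * x ^+ 2)))%:C * ((expR (- (s * y ^+ 2)))%:C * K%:C)).
  under eq_fun do rewrite FE rmorphM.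
  rewrite mulrA -rmorphM; apply: is_cintegralZl.
  exact: (is_cintegral_tadd _ (IHk B pB)).
have mcons n : measurable_fun setT (@cons_pair R n) := @measurable_cons_pair R n.
have -> : (pi ^+ k.+1 / absdet A)%:C = ((q * q) * K)%:C.
  by congr (_%:C); rewrite q2 /K aE exprS; field; rewrite !gt_eqF.
pose H (t : Rn k.*2.+2) : R := expR (- complex.Re (qform A (cvec (t : Rn k.+1.*2)))).
have mH : measurable_fun setT H := mq k.+1 A.
have mH1 : measurable_fun setT (fun z => H (cons_pair z)).
  exact: (measurableT_comp mH (mcons _)).
have mH2 x : measurable_fun setT (fun t => H (cons_pair (x, t))).
  exact: (measurableT_comp mH1 (measurable_pair1 x)).
have mH3 x : measurable_fun setT (fun z => H (cons_pair (x, cons_pair z))).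
  exact: (measurableT_comp (mH2 x) (mcons _)).
have H0 t : 0 <= H t by exact: expR_ge0.
have I1 x : is_cintegral (leb k.*2.+1) (fun t => (H (cons_pair (x, t)))%:C)
    (expR (- (s * x ^+ 2)) * (q * K))%:C.
  apply: (is_cintegral_cons (cmeasurable_real (mH2 x))).
  refine (@is_cintegral_prod12_ge0 _ _ _ _ _ (@lebesgue_measure R) (leb k.*2)
    (fun z => H (cons_pair (x, cons_pair z)))
    (fun y => expR (- (s * x ^+ 2)) * (expR (- (s * y ^+ 2)) * K)) _ (mH3 x)
    (fun=> H0 _) _ _).
  - by move=> y; have := I0 x y; rewrite -!rmorphM.
  - under eq_fun do rewrite !rmorphM.
    rewrite !rmorphM; apply: is_cintegralZl; apply: is_cintegralZr.
    exact: is_cintegral_gauss.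
apply: (@is_cintegral_cons R k.*2.+1 (fun t => (H t)%:C) _ (cmeasurable_real mH)).
refine (@is_cintegral_prod12_ge0 _ _ _ _ _ (@lebesgue_measure R) (leb k.*2.+1)
  (fun z => H (cons_pair z)) (fun x => expR (- (s * x ^+ 2)) * (q * K)) _ mH1
  (fun=> H0 _) I1 _).
under eq_fun do rewrite rmorphM.
rewrite -mulrA !rmorphM; apply: is_cintegralZr; exact: is_cintegral_gauss.
Qed.

End gaussian.

(** * The matrix gamma integral *)

Section matrix_gamma.
Variable R : realType.
Local Notation C := R[i].
Local Notation L := (measurableTypeR R).
Local Notation Rn n := (n.-tuple L).
Local Notation leb := (lebesgue_tuple R).
Local Notation pos := (`]0, +oo[%classic : set R).

Definition mgamma_fun p (A : 'M[C]_p) (a : C) (t : Rn (p * p)) : C :=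
  (\1_(posdef_set R p) t)%:C *
  (cexp (- \tr (A *m herm_mx t)) * cpow (absdet (herm_mx t)) (a - p%:R)).

Lemma cmeasurable_cexp_trace d (T : measurableType d) p (A X : T -> 'M[C]_p) :
  mxmeasurable A -> mxmeasurable X ->
  cmeasurable (fun x => cexp (- \tr (A x *m X x))).
Proof.
move=> mA mX; apply: cmeasurable_cexp; apply: cmeasurableN.
by apply: cmeasurable_trace; exact: mxmeasurableM.
Qed.

Lemma cmeasurable_mgamma_fun p (A : 'M[C]_p) a : cmeasurable (mgamma_fun A a).
Proof.
have mh : mxmeasurable (fun t : Rn (p * p) => herm_mx t).
  exact: (mxmeasurable_herm (@measurable_id _ _ _)).
apply: cmeasurableM; first by apply: cmeasurable_indic; exact: measurable_posdef.
apply: cmeasurableM; last by apply: cmeasurable_cpow; exact: measurable_absdet.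
by apply: cmeasurable_cexp_trace => //; exact: mxmeasurable_cst.
Qed.

(** The exponent [p (p - 1) / 2] is ['C(p, 2)], so Pascal's rule supplies [pi ^+ p]; passing to
    [a - 1] absorbs the index shift of the product. *)
Lemma cGamma_mxS p (a : C) :
  cGamma_mx p.+1 a = (pi ^+ p)%:C * cGamma a * cGamma_mx p (a - 1).
Proof.
rewrite /cGamma_mx big_ord_recl subr0 -!bin2 binS bin1 exprD rmorphM.
have e (i : 'I_p) : a - (lift ord0 i)%:R = a - 1 - i%:R by rewrite lift0 -natr1; ring.
under eq_bigr do rewrite e.
set P := \prod_(i < p) _; set c1 := (pi ^+ 'C(p, 2))%:C; ring.
Qed.

Lemma cpow_conv_nat (x : R) (a : C) n : 0 < x ->
  cpow x (a - n.+1%:R) * (x ^+ n)%:C = cpow x (a - 1).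
Proof.
by move=> x0; rewrite -cpow_nat// -cpowD; congr cpow; rewrite -natr1; ring.
Qed.

(** Bookkeeping of exponents for size [k + 1]: the Gaussian integral gives [x^k pi^k / |B|]. Its
    [x^k] raises [a - (k + 1)] to [a - 1], hence the scalar [cGamma a]. The exponent of [|Y|] is
    [(a - 1) - k], so the induction hypothesis applies at [a - 1], and [1 / |B|] turns its power
    [1 - a] of [|B|] into [- a]. *)
Theorem is_cintegral_mgamma p (A : 'M[C]_p) (a : C) :
  p%:R - 1 < complex.Re a -> posdefmx A ->
  is_cintegral (leb (p * p)) (mgamma_fun A a) (cGamma_mx p a * cpow (absdet A) (- a)).
Proof.
elim: p A a => [|k IHk] A a ap pA.
  have := is_cintegral_dim0 (cmeasurable_mgamma_fun A a).
  rewrite /mgamma_fun /cGamma_mx indicE mem_set; last exact: posdefmx_dim0.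
  rewrite /absdet !det_mx00 Normc.normc1 !cpow1l big_ord0 /mxtrace big_ord0 oppr0 cexp0.
  by rewrite expr0 !mulr1.
have [s [w [B [s0 pB AE]]]] := @posdefmx_schurP R k A pA.
have aE : absdet A = s * absdet B by rewrite AE; apply: absdet_schur; exact: ltW.
have aB := absdet_gt0 pB.
have a0 : 0 < complex.Re a.
  by apply: le_lt_trans ap; rewrite -natr1 addrK.
have ak : k%:R - 1 < complex.Re (a - 1).
  by rewrite ReD ReN /= ltrD2r; move: ap; rewrite -natr1 addrK.
pose c (x : R) : C := (\1_pos x)%:C * (cpow x (a - k.+1%:R) * (expR (- (s * x)))%:C).
pose e (x : R) (v : Rn k.*2) : R :=
  expR (- complex.Re (qform ((x^-1)%:C *: B) (cvec v + x%:C *: w))).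
pose g (u : Rn k.*2.+1) : C := c (thead u) * (e (thead u) (behead_tuple u))%:C.
have fE z : mgamma_fun A a (schur_coords z) = g z.1 * mgamma_fun B (a - 1) z.2.
  case: z => u t; rewrite /mgamma_fun /g /c !indicE /=.
  have hE := herm_mx_schur_coords (u, t); rewrite /= in hE.
  set x := thead u in hE *; set v := behead_tuple u in hE *.
  have pE : (schur_coords (u, t) \in posdef_set R k.+1) =
      (x \in pos) && (t \in posdef_set R k).
    apply/idP/andP; rewrite !inE /posdef_set /= hE in_itv/= andbT /=.
      by move=> /posdefmx_schur_mx.
    by move=> ?; apply/posdefmx_schur_mx.
  rewrite pE; have [xp|] := boolP (x \in pos); last by rewrite !mul0r.
  have [tp|] := boolP (t \in posdef_set R k); last by rewrite !mul0r mulr0.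
  move: xp tp; rewrite !inE /= in_itv/= andbT => x0 tp.
  rewrite !mul1r hE absdet_schur_mx// cpowMl ?absdet_gt0//.
  rewrite [in LHS]AE mxtrace_schur// !opprD !cexpD /e /=.
  have -> : cexp (- (s * x)%:C) = (expR (- (s * x)))%:C by rewrite -rmorphN cexpR.
  set q := qform _ _; have q0 : 0 <= q.
    by apply: qform_ge0; apply: posdefmxZ; rewrite ?invr_gt0.
  have -> : cexp (- q) = (expR (- complex.Re q))%:C.
    by rewrite -cexpR rmorphN /= RRe_real// ger0_real.
  have -> : a - 1 - k%:R = a - k.+1%:R by rewrite -natr1; ring.
  by ring.
have mc : cmeasurable (c : L -> C).
  apply: cmeasurableM; first by apply: cmeasurable_indic; exact: measurable_itv.
  apply: cmeasurableM; first exact: (cmeasurable_cpow _ (@measurable_id _ _ _)).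
  apply: cmeasurable_real; apply: (measurableT_comp (@measurable_expR R)).
  by apply: measurableT_comp => //; exact: measurable_funM.
have me : measurable_fun setT (fun z : L * Rn k.*2 => e z.1 z.2).
  apply: (measurableT_comp (@measurable_expR R)); apply: measurableT_comp => //.
  have mz : cmeasurable (fun z : L * Rn k.*2 => z.1%:C : C).
    by apply: cmeasurable_real; exact: measurable_fst.
  have mzi : cmeasurable (fun z : L * Rn k.*2 => (z.1^-1)%:C : C).
    by apply: cmeasurable_real; apply: measurable_invr; exact: measurable_fst.
  have h : cmeasurable (fun z : L * Rn k.*2 =>
      qform ((z.1^-1)%:C *: B) (cvec z.2 + z.1%:C *: w)).
    apply: cmeasurable_qform.
      by apply: mxmeasurableZ => //; exact: mxmeasurable_cst.
    apply: mxmeasurableD; first by apply: mxmeasurable_cvec; exact: measurable_snd.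
    by apply: mxmeasurableZ => //; exact: mxmeasurable_cst.
  exact: h.1.
have ei (x : R) : 0 < x ->
    is_cintegral (leb k.*2) (fun v => (e x v)%:C) (x ^+ k * (pi ^+ k / absdet B))%:C.
  move=> x0; have xi : 0 < x^-1 by rewrite invr_gt0.
  (* The Gaussian is centred at [- x w]; a translation moves it to the origin. *)
  have h := is_cintegral_tadd (cvec_coords (x%:C *: w))
    (is_cintegral_gauss_qform (posdefmxZ xi pB)).
  apply: eq_is_cintegral h => [v|]; first by rewrite cvec_tadd cvec_coordsK addrC.
  by rewrite absdetZ ?(ltW xi)// exprVn invfM invrK; congr (_%:C); ring.
pose K := pi ^+ k / absdet B.
have K0 : 0 <= K by rewrite divr_ge0 ?exprn_ge0 ?pi_ge0 ?ltW.
pose G (x : R) : C := K%:C * ((\1_pos x)%:C * (cpow x (a - 1) * (expR (- (s * x)))%:C)).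
have GE x : 0 < x -> G x = c x * (x ^+ k * K)%:C.
  move=> x0; rewrite /G -(cpow_conv_nat a k x0) /c.
  have -> : (x ^+ k * K)%:C = (x ^+ k)%:C * K%:C by exact: rmorphM.
  ring.
have c0 x : x <= 0 -> c x = 0.
  by move=> x0; rewrite /c indicE memNset ?mul0r//= in_itv/= andbT ltNge x0.
have G0 x : x <= 0 -> G x = 0.
  by move=> x0; rewrite /G indicE memNset ?mul0r ?mulr0//= in_itv/= andbT ltNge x0.
have Gi : is_cintegral lebesgue_measure (G : L -> C) (K%:C * (cGamma a * cpow s (- a))).
  by apply: is_cintegralZl; exact: is_cintegral_gamma_scale.
have [M GM] := is_cintegral_norm Gi.
pose g2 (z : L * Rn k.*2) : C := c z.1 * (e z.1 z.2)%:C.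
have mg2 : cmeasurable g2.
  apply: cmeasurableM; last exact: cmeasurable_real.
  exact: (cmeasurable_comp mc measurable_fst).
have g2i x : is_cintegral (leb k.*2) (fun v => g2 (x, v)) (G x).
  rewrite /g2 /=; have [x0|x0] := leP x 0.
    by rewrite c0// G0//; under eq_fun do rewrite mul0r; exact: is_cintegral0.
  by rewrite GE//; apply: is_cintegralZl; exact: ei.
(* Since [e] is positive, the modulus affects [c] only, and the inner integral of the modulus is the
   modulus of [G]. *)
have g2n x : is_cintegral (leb k.*2) (fun v => (Normc.normc (g2 (x, v)))%:C)
    (Normc.normc (G x))%:C.
  rewrite /g2 /=; have [x0|x0] := leP x 0.
    rewrite c0// G0//; under eq_fun do rewrite mul0r Normc.normc0.
    by rewrite Normc.normc0; exact: is_cintegral0.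
  have xK0 : 0 <= x ^+ k * K by apply: mulr_ge0 => //; rewrite exprn_ge0// ltW.
  rewrite GE// Normc.normcM normc_real (ger0_norm xK0) rmorphM.
  under eq_fun do rewrite Normc.normcM normc_real ger0_norm ?expR_ge0// rmorphM.
  by apply: is_cintegralZl; exact: ei.
have g2I := is_cintegral_prod12 mg2 g2i g2n GM Gi.
have mth : measurable_fun setT (fun u : Rn k.*2.+1 => (thead u, behead_tuple u) : L * Rn k.*2).
  by apply/measurable_fun_pairP; split; [exact: measurable_thead|exact: measurable_behead_tuple].
have mg : cmeasurable g := cmeasurable_comp mg2 mth.
have gi : is_cintegral (leb k.*2.+1) g (K%:C * (cGamma a * cpow s (- a))).
  apply: (is_cintegral_cons mg).
  have -> : (fun z => g (cons_pair z)) = g2; last exact: g2I.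
  apply/funext => -[x v]; rewrite /g /g2 /=.
  have -> : behead_tuple (cons_pair (x, v)) = v by exact/val_inj.
  by rewrite /cons_pair theadE.
have := is_cintegral_tensor gi (IHk B (a - 1) ak pB).
have -> : (K%:C * (cGamma a * cpow s (- a))) * (cGamma_mx k (a - 1) * cpow (absdet B) (- (a - 1)))
    = cGamma_mx k.+1 a * cpow (absdet A) (- a).
  rewrite cGamma_mxS aE cpowMl// opprB addrC cpowD /K rmorphM fmorphV /=.
  have -> : cpow (absdet B) 1 = (absdet B)%:C by rewrite (cpow_nat 1)// expr1.
  by field; rewrite eq_complex /= eqxx andbT gt_eqF.
have -> : (fun z => g z.1 * mgamma_fun B (a - 1) z.2) =
    (fun z => mgamma_fun A a (schur_coords z)) by apply/funext => z; rewrite fE.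
exact: (is_cintegral_schur_coords (cmeasurable_mgamma_fun A a)).
Qed.

End matrix_gamma.

(** * The type-2 Dirichlet average *)

Section dirichlet.
Variable R : realType.
Local Notation C := R[i].
Local Notation L := (measurableTypeR R).
Local Notation Rn n := (n.-tuple L).
Local Notation leb := (lebesgue_tuple R).

Lemma cGamma_mx_gt0 p (x : R) : p%:R - 1 < x ->
  exists2 g : R, 0 < g & cGamma_mx p x%:C = g%:C.
Proof.
move=> px; rewrite /cGamma_mx.
have [g g0 ->] : exists2 g : R, 0 < g & \prod_(j < p) cGamma (x%:C - j%:R) = g%:C.
  elim/big_ind : _ => [|_ _ [u u0 ->] [v v0 ->]|j _].
  - by exists 1.
  - by exists (u * v); [rewrite mulr_gt0|rewrite rmorphM].
  - rewrite natC -rmorphB; apply: cGamma_gt0; rewrite subr_gt0.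
    apply: le_lt_trans px; rewrite lerBrDr natr1 ler_nat; exact: ltn_ord.
by exists (pi ^+ (p * p.-1)./2 * g); [rewrite mulr_gt0// exprn_gt0// pi_gt0|rewrite rmorphM].
Qed.

Lemma cGamma_mx_neq0 p (a : C) : p%:R - 1 < complex.Re a -> cGamma_mx p a != 0.
Proof.
move=> pa; rewrite /cGamma_mx mulf_neq0//.
  by rewrite eq_complex /= eqxx andbT gt_eqF// exprn_gt0// pi_gt0.
apply/prodf_neq0 => j _; apply: cGamma_neq0; rewrite ReD ReN Re_nat subr_gt0.
apply: le_lt_trans pa; rewrite lerBrDr natr1 ler_nat; exact: ltn_ord.
Qed.

Lemma normc_indicM (T : Type) (D : set T) x (z : C) :
  (Normc.normc ((\1_D x)%:C * z))%:C = (\1_D x)%:C * (Normc.normc z)%:C.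
Proof. by rewrite normCM normc_real ger0_norm. Qed.

Lemma normc_indicMM (T : Type) (D E : set T) x y (u v w : C) :
  (Normc.normc ((\1_D x)%:C * u * ((\1_E y)%:C * (v * w))))%:C =
  (\1_D x)%:C * (Normc.normc u)%:C *
    ((\1_E y)%:C * ((Normc.normc v)%:C * (Normc.normc w)%:C)).
Proof. by rewrite normCM !normc_indicM normCM. Qed.

Lemma normc_cpow_nat (x : R) (a : C) n :
  (Normc.normc (cpow x (a - n%:R)))%:C = cpow x ((complex.Re a)%:C - n%:R).
Proof. by rewrite normc_cpowE ReD ReN Re_nat natC rmorphB. Qed.

Lemma normc_cexp_trace p (A X : 'M[C]_p) : A \is hermsymmx -> X \is hermsymmx ->
  (Normc.normc (cexp (- \tr (A *m X))))%:C = cexp (- \tr (A *m X)).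
Proof.
move=> hA hX; rewrite normc_cexp -cexpR; congr cexp.
by rewrite [RHS]complexE ImN (mxtrace_herm_real hA hX) oppr0 mulr0 addr0.
Qed.

Lemma mgamma_fun_normc p (A : 'M[C]_p) (a : C) t : A \is hermsymmx ->
  (Normc.normc (mgamma_fun A a t))%:C = mgamma_fun A (complex.Re a)%:C t.
Proof.
move=> hA; rewrite /mgamma_fun normc_indicM (normCM (cexp _)) normc_cpow_nat.
by rewrite (normc_cexp_trace hA (herm_mx_hermsymm t)).
Qed.

(** * The type-2 beta integral *)

Section type2_beta.
Variables (p : nat) (B : 'M[C]_p).
Hypotheses (p1 : (1 <= p)%N) (pB : posdefmx B).
Let hB : B \is hermsymmx := pB.1.

Let PD := posdef_set R p.

Let F (a s : C) (z : Rn (p * p) * Rn (p * p)) : C :=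
  (\1_PD z.1)%:C * cpow (absdet (herm_mx z.1)) (a - p%:R) *
  ((\1_PD z.2)%:C * (cexp (- \tr ((B + herm_mx z.1) *m herm_mx z.2)) *
    cpow (absdet (herm_mx z.2)) (s - p%:R))).

Let mherm : mxmeasurable (fun t : Rn (p * p) => herm_mx t).
Proof. exact: (mxmeasurable_herm (@measurable_id _ _ _)). Qed.

Let mF a s : cmeasurable (F a s).
Proof.
have mI : cmeasurable (fun t : Rn (p * p) => (\1_PD t)%:C : C).
  by apply: cmeasurable_indic; exact: measurable_posdef.
have m1 : mxmeasurable (fun z : Rn (p * p) * Rn (p * p) => herm_mx z.1).
  by apply: mxmeasurable_herm; exact: measurable_fst.
have m2 : mxmeasurable (fun z : Rn (p * p) * Rn (p * p) => herm_mx z.2).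
  by apply: mxmeasurable_herm; exact: measurable_snd.
apply: cmeasurableM; apply: cmeasurableM.
- exact: (cmeasurable_comp mI measurable_fst).
- by apply: cmeasurable_cpow; exact: measurable_absdet.
- exact: (cmeasurable_comp mI measurable_snd).
apply: cmeasurableM.
  apply: (@cmeasurable_cexp_trace _ _ _ p (fun z : Rn (p * p) * Rn (p * p) => B + herm_mx z.1)
    (fun z => herm_mx z.2)); last exact: m2.
  by apply: mxmeasurableD; [exact: mxmeasurable_cst|exact: m1].
by apply: cmeasurable_cpow; exact: measurable_absdet.
Qed.

Let normF a s z : (Normc.normc (F a s z))%:C = F (complex.Re a)%:C (complex.Re s)%:C z.
Proof.
have hBz := hermsymmD hB (herm_mx_hermsymm z.1).
apply: (eq_trans (normc_indicMM _ _ _ _ _ _ _)); congr (_ * _ * (_ * (_ * _))).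
- exact: normc_cpow_nat.
- exact: (normc_cexp_trace hBz (herm_mx_hermsymm z.2)).
- exact: normc_cpow_nat.
Qed.

(** For fixed [Z] the integral over [Y] is a matrix gamma integral with constant matrix [Z]; its
    factor [|Z|^- a] lowers the exponent [a + b - p] of [|Z|] to [b - p]. *)
Let FZ a b t : p%:R - 1 < complex.Re a ->
  is_cintegral (leb (p * p)) (fun y => F a (a + b) (y, t))
    (cGamma_mx p a * mgamma_fun B b t).
Proof.
move=> pa; rewrite /mgamma_fun indicE.
have [|tP] := boolP (t \in PD); last first.
  rewrite mul0r mulr0; apply: eq_is_cintegral (is_cintegral0 _) => // y.
  by rewrite /F /= !indicE (negbTE tP) mul0r mulr0.
rewrite inE => tP.
have pZ : posdefmx (herm_mx t) := tP.
have h := is_cintegralZl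
  (cexp (- \tr (B *m herm_mx t)) * cpow (absdet (herm_mx t)) (a + b - p%:R))
  (is_cintegral_mgamma pa pZ).
apply: eq_is_cintegral h => [y|].
  rewrite /F /mgamma_fun /= [\1_PD t]indicE (mem_set tP) mul1r mulmxDl mxtraceD opprD cexpD.
  rewrite (mxtrace_mulC (herm_mx t)).
  move: (\1_PD y)%:C (cpow _ _) (cexp _) (cexp _) (cpow _ _) => u1 u2 u3 u4 u5.
  ring.
rewrite (_ : a + b - p%:R = (b - p%:R) + a); last by ring.
rewrite (cpowD _ (b - p%:R) a) cpowN.
have gen (u1 u2 u3 u4 : C) : u1 != 0 -> u3 * (u2 * u1) * (u4 * u1^-1) = u4 * (u3 * u2).
  by move=> u10; field.
rewrite mul1r; exact: (gen _ _ _ _ (cpow_neq0 _ a)).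
Qed.

Let FY a s t : p%:R - 1 < complex.Re s ->
  is_cintegral (leb (p * p)) (fun z => F a s (t, z))
    ((\1_PD t)%:C * (cpow (absdet (herm_mx t)) (a - p%:R) *
      (cGamma_mx p s * cpow (absdet (B + herm_mx t)) (- s)))).
Proof.
move=> ps; rewrite indicE; have [|tP] := boolP (t \in PD); last first.
  rewrite mul0r; apply: eq_is_cintegral (is_cintegral0 _) => // y.
  by rewrite /F /= indicE (negbTE tP) !mul0r.
rewrite inE => tP.
have h := is_cintegralZl (cpow (absdet (herm_mx t)) (a - p%:R))
  (is_cintegral_mgamma ps (posdefmxD pB tP)).
by apply: eq_is_cintegral h => [z|]; rewrite ?mul1r// /F /= indicE (mem_set tP) mul1r.
Qed.

(* [cGamma_mx p (a + b) * |B + Y|^-(a + b)] is itself an integral over [Z]; in the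
   double integral [F], integrating over [Y] first leaves a matrix gamma integral. *)
Theorem is_cintegral_type2_beta a b :
  p%:R - 1 < complex.Re a -> p%:R - 1 < complex.Re b ->
  is_cintegral (leb (p * p))
    (fun t => (\1_PD t)%:C * (cpow (absdet (herm_mx t)) (a - p%:R) *
      (cGamma_mx p (a + b) * cpow (absdet (B + herm_mx t)) (- (a + b)))))
    (cGamma_mx p a * (cGamma_mx p b * cpow (absdet B) (- b))).
Proof.
move=> pa pb.
(* As [p - 1] is nonnegative, the lower bound on the real parts of [a] and [b] passes to their
   sum. *)
have p0 : 0 <= p%:R - 1 :> R by rewrite subr_ge0 ler1n.
have pab : p%:R - 1 < complex.Re (a + b) by rewrite ReD; lra.
have par : p%:R - 1 < complex.Re (complex.Re a)%:C by [].
have [g g0 gE] := cGamma_mx_gt0 pa.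
have G := is_cintegralZl (cGamma_mx p a) (is_cintegral_mgamma pb pB).
have [M GM] := is_cintegral_norm (is_cintegral_mgamma pb pB).
have GM' : is_cintegral (leb (p * p))
    (fun t => (g * Normc.normc (mgamma_fun B b t))%:C) (g%:C * M%:C).
  by apply: eq_is_cintegral (is_cintegralZl g%:C GM) => // t; rewrite rmorphM.
(* The inner integral of the modulus is [FZ] at the real parts, where [cGamma_mx] takes the positive
   value [g]. *)
have FN t : is_cintegral (leb (p * p))
    (fun y => (Normc.normc (F a (a + b) (y, t)))%:C)
    (g * Normc.normc (mgamma_fun B b t))%:C.
  have h := FZ (complex.Re b)%:C t par.
  apply: eq_is_cintegral h => [y|]; first by rewrite normF ReD rmorphD.
  by rewrite gE rmorphM /= mgamma_fun_normc.
have FI := is_cintegral_prod21 (mF a (a + b)) (fun t => FZ b t pa) FN GM' G.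
exact: (is_cintegral_fubini1 FI (fun t => FY a t pab)).
Qed.

End type2_beta.

End dirichlet.

Lemma indic_setX (R : realType) (T U : Type) (D : set T) (E : set U) (z : T * U) :
  (\1_(D `*` E) z)%:C = (\1_D z.1)%:C * (\1_E z.2)%:C :> R[i].
Proof.
rewrite -rmorphM; congr (_%:C); rewrite !indicE -natrM mulnb.
congr (nat_of_bool _)%:R; apply/idP/andP.
  by move=> /set_mem[z1 z2]; split; exact: mem_set.
by move=> [/set_mem z1 /set_mem z2]; apply: mem_set; split.
Qed.

(** * Evaluation of the average *)

Section dirichlet_average.
Variables (R : realType) (p : nat) (A : 'M[R[i]]_p) (a1 a2 a3 : R[i]).
Local Notation C := R[i].
Local Notation L := (measurableTypeR R).
Local Notation Rn n := (n.-tuple L).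
Local Notation leb := (lebesgue_tuple R).
Hypotheses (p1 : (1 <= p)%N) (pA : posdefmx A).
Hypotheses (h1 : p%:R - 1 < complex.Re a1) (h2 : p%:R - 1 < complex.Re a2).
Hypothesis h3 : p%:R - 1 < complex.Re a3.

Let PD := posdef_set R p.
Let b := a1 + a3.
Let K := (cGamma_mx p a1 * cGamma_mx p a2 * cGamma_mx p a3)^-1.

Let outer (t : Rn (p * p)) : C := K * (mgamma_fun A a1 t * cpow (absdet (1%:M + herm_mx t)) b).

(** The numerator of the normalising constant is kept here, because [is_cintegral_type2_beta]
    carries it in its integrand. Everything depending on [X_1] alone is in [outer]. *)
Let inner (a s : C) (t u : Rn (p * p)) : C :=
  (\1_PD u)%:C * (cpow (absdet (herm_mx u)) (a - p%:R) *
    (cGamma_mx p s * cpow (absdet (1%:M + herm_mx t + herm_mx u)) (- s))).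

Let F (z : Rn (p * p) * Rn (p * p)) : C := outer z.1 * inner a2 (a2 + b) z.1 z.2.

Let integrandE z :
  (\1_(@posdef_pairs R p) z)%:C *
    (phi6 A a1 a3 (herm_mx z.1) (herm_mx z.2) *
     dirichlet2_density a1 a2 a3 (herm_mx z.1) (herm_mx z.2)) = F z.
Proof.
have abE : a1 + a2 + a3 = a2 + b by rewrite /b addrCA addrA.
have indicE2 : (\1_(@posdef_pairs R p) z)%:C = (\1_PD z.1)%:C * (\1_PD z.2)%:C :> C.
  exact: (indic_setX R PD PD z).
have gen (i1 i2 e d g k q1 q2 q : C) :
    i1 * i2 * (e * d * (g * k * q1 * q2 * q)) =
    k * (i1 * (e * q1) * d) * (i2 * (q2 * (g * q))) by ring.
rewrite indicE2 /phi6 /dirichlet2_density abE; exact: gen.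
Qed.

Let mherm : mxmeasurable (fun t : Rn (p * p) => herm_mx t).
Proof. exact: (mxmeasurable_herm (@measurable_id _ _ _)). Qed.

Let mF : cmeasurable F.
Proof.
have m1 : mxmeasurable (fun z : Rn (p * p) * Rn (p * p) => herm_mx z.1).
  by apply: mxmeasurable_herm; exact: measurable_fst.
have m2 : mxmeasurable (fun z : Rn (p * p) * Rn (p * p) => herm_mx z.2).
  by apply: mxmeasurable_herm; exact: measurable_snd.
have m3 : mxmeasurable (fun z : Rn (p * p) * Rn (p * p) => 1%:M + herm_mx z.1).
  by apply: mxmeasurableD; [exact: mxmeasurable_cst|exact: m1].
have mI : cmeasurable (fun t : Rn (p * p) => (\1_PD t)%:C : C).
  by apply: cmeasurable_indic; exact: measurable_posdef.
have mo : cmeasurable outer.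
  apply: cmeasurableM; first exact: cmeasurable_cst.
  apply: cmeasurableM; first exact: cmeasurable_mgamma_fun.
  apply: cmeasurable_cpow; apply: measurable_absdet.
  by apply: mxmeasurableD; [exact: mxmeasurable_cst|exact: mherm].
apply: cmeasurableM; first exact: (cmeasurable_comp mo measurable_fst).
apply: cmeasurableM.
  exact: (cmeasurable_comp mI measurable_snd).
apply: cmeasurableM; first exact: (cmeasurable_cpow _ (measurable_absdet m2)).
apply: cmeasurableM; first exact: cmeasurable_cst.
exact: (cmeasurable_cpow _ (measurable_absdet (mxmeasurableD m3 m2))).
Qed.

Let hb : p%:R - 1 < complex.Re b.
Proof.
have p0 : 0 <= p%:R - 1 :> R by rewrite subr_ge0 ler1n.
by rewrite /b ReD (lt_le_trans h1)// lerDl (le_trans p0)// ltW.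
Qed.

Let outer_out t : t \notin PD -> outer t = 0.
Proof.
by move=> tP; rewrite /outer /mgamma_fun indicE (negbTE tP) !mul0r mulr0.
Qed.

Let c : C := K * (cGamma_mx p a2 * cGamma_mx p b).

Let outer_inner t :
  outer t * (cGamma_mx p a2 * (cGamma_mx p b * cpow (absdet (1%:M + herm_mx t)) (- b))) =
  c * mgamma_fun A a1 t.
Proof.
rewrite /outer /c cpowN; have := cpow_neq0 (absdet (1%:M + herm_mx t)) b.
have gen (u1 u2 u3 u4 u5 : C) : u4 != 0 ->
    u5 * (u1 * u4) * (u2 * (u3 * u4^-1)) = u5 * (u2 * u3) * u1 by move=> ?; field.
exact: gen.
Qed.

Let F_inner t :
  is_cintegral (leb (p * p)) (fun u => F (t, u)) (c * mgamma_fun A a1 t).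
Proof.
(* The beta integral needs [I + X_1] positive definite; for other [t] the indicator in [outer] makes
   both sides vanish. *)
have [tP|tP] := boolP (t \in PD); last first.
  rewrite -outer_inner outer_out// mul0r.
  by apply: eq_is_cintegral (is_cintegral0 _) => // u; rewrite /F /= outer_out// mul0r.
rewrite inE in tP; have pt := posdefmxD (posdefmx1 R p) tP.
rewrite -outer_inner.
exact: (is_cintegralZl (outer t) (is_cintegral_type2_beta p1 pt h2 hb)).
Qed.

(** Taking moduli replaces parameters by their real parts except in the constant [cGamma_mx p s],
    whose modulus may differ from the value [g] at the real part; the ratio corrects for this. *)
Let inner_normc a s (g : R) t u : 0 < g -> cGamma_mx p (complex.Re s)%:C = g%:C ->
  (Normc.normc (inner a s t u))%:C =
  (Normc.normc (cGamma_mx p s) / g)%:C * inner (complex.Re a)%:C (complex.Re s)%:C t u.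
Proof.
move=> g0 gE; apply: (eq_trans (normc_indicM _ _ _)).
rewrite /inner gE (normCM (cpow _ _)) (normCM (cGamma_mx _ _)) normc_cpow_nat.
rewrite normc_cpowE ReN rmorphN.
have gC : g%:C != 0 :> C by rewrite eq_complex /= eqxx andbT gt_eqF.
rewrite rmorphM fmorphV /=.
have gen (u1 u2 u3 u4 g' : C) : g' != 0 ->
    u1 * (u2 * (u4 * u3)) = u4 * g'^-1 * (u1 * (u2 * (g' * u3))) by move=> ?; field.
exact: gen.
Qed.

(** The constant is left existential, since the lemma feeds Tonelli's criterion, where only
    finiteness counts. *)
Let F_inner_norm : exists k : R, forall t,
  is_cintegral (leb (p * p)) (fun u => (Normc.normc (F (t, u)))%:C)
    (k * Normc.normc (mgamma_fun A a1 t))%:C.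
Proof.
have p0 : 0 <= p%:R - 1 :> R by rewrite subr_ge0 ler1n.
have hs : p%:R - 1 < complex.Re (a2 + b) by rewrite ReD (lt_le_trans h2)// lerDl (le_trans p0)// ltW.
have h2' : p%:R - 1 < complex.Re (complex.Re a2)%:C by [].
have hb' : p%:R - 1 < complex.Re (complex.Re b)%:C by exact: hb.
have [g g0 gE] := cGamma_mx_gt0 hs.
have [g2 _ g2E] := cGamma_mx_gt0 h2'.
have [gb _ gbE] := cGamma_mx_gt0 hb'.
exists (Normc.normc K * (Normc.normc (cGamma_mx p (a2 + b)) / g) * (g2 * gb)) => t.
have [tP|tP] := boolP (t \in PD); last first.
  have -> : mgamma_fun A a1 t = 0 by rewrite /mgamma_fun indicE (negbTE tP) mul0r.
  rewrite Normc.normc0 mulr0.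
  apply: eq_is_cintegral (is_cintegral0 _) => // u.
  by rewrite /F /= outer_out// mul0r Normc.normc0.
rewrite inE in tP; have pt := posdefmxD (posdefmx1 R p) tP.
have h := is_cintegralZl ((Normc.normc (outer t))%:C * (Normc.normc (cGamma_mx p (a2 + b)) / g)%:C)
  (is_cintegral_type2_beta p1 pt h2' hb').
apply: eq_is_cintegral h => [u|].
  rewrite [RHS](normCM (outer t)) (inner_normc _ _ _ g0 gE) ReD.
  by rewrite [in RHS]mulrA /inner rmorphD.
rewrite g2E gbE /outer (normCM K) (normCM (mgamma_fun _ _ _)) normc_cpowE cpowN !rmorphM.
have gen (u1 u2 u3 u4 u5 u6 : C) : u6 != 0 ->
    u1 * (u2 * u6) * u3 * (u4 * (u5 * u6^-1)) = u1 * u3 * (u4 * u5) * u2 by move=> ?; field.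
exact: (gen _ _ _ _ _ _ (cpow_neq0 _ _)).
Qed.

Let F_integral : is_cintegral (leb (p * p) \x leb (p * p))%E F
  (c * (cGamma_mx p a1 * cpow (absdet A) (- a1))).
Proof.
have [k FN] := F_inner_norm.
have [r Nr] := is_cintegral_norm (is_cintegral_mgamma h1 pA).
have NM : is_cintegral (leb (p * p))
    (fun t => (k * Normc.normc (mgamma_fun A a1 t))%:C) (k%:C * r%:C).
  by apply: eq_is_cintegral (is_cintegralZl k%:C Nr) => // t; rewrite rmorphM.
exact: (is_cintegral_prod12 mF F_inner FN NM (is_cintegralZl c (is_cintegral_mgamma h1 pA))).
Qed.

Lemma dirichlet2_average_phi6 :
  dirichlet2_integrable a1 a2 a3 (phi6 A a1 a3) /\
  dirichlet2_average a1 a2 a3 (phi6 A a1 a3) =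
    cGamma_mx p (a1 + a3) / cGamma_mx p a3 * cpow (absdet A) (- a1).
Proof.
have mD : measurable (@posdef_pairs R p).
  exact: (measurableX (@measurable_posdef R p) (@measurable_posdef R p)).
(* The gamma values at [a1] and [a2] produced by the two integrations cancel against the denominator
   of the density; this is where non-vanishing of Gamma at complex parameters enters. *)
have gen (u1 u2 u3 v w : C) : u1 != 0 -> u2 != 0 -> u3 != 0 ->
    (u1 * u2 * u3)^-1 * (u2 * v) * (u1 * w) = v / u3 * w.
  by move=> *; field; apply/and3P.
apply: (is_cintegral_indic mD); apply: eq_is_cintegral F_integral => [z|].
  by rewrite integrandE.
exact: (gen _ _ _ _ _ (cGamma_mx_neq0 h1) (cGamma_mx_neq0 h2) (cGamma_mx_neq0 h3)).
Qed.

End dirichlet_average.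

Theorem mainTheorem6 (R : realType) (p : nat) (hp : (1 <= p)%N)
    (a1 a2 a3 : R[i])
    (h1 : p%:R - 1 < complex.Re a1)
    (h2 : p%:R - 1 < complex.Re a2)
    (h3 : p%:R - 1 < complex.Re a3)
    (A : 'M[R[i]]_p) (hA : posdefmx A) :
  dirichlet2_integrable a1 a2 a3 (phi6 A a1 a3) /\
  dirichlet2_average a1 a2 a3 (phi6 A a1 a3) =
    cGamma_mx p (a1 + a3) / cGamma_mx p a3 * cpow (absdet A) (- a1).
Proof. exact: dirichlet2_average_phi6. Qed.
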